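(* Let $p\in(0,1]$ and $k\in\mathbb{N}$ be constants and let $P>(1-p)^{2^{k-1}}\varphi$, where $\varphi=\frac{1}{2}(\sqrt{5}+1)$ is the golden ratio. Suppose that for any model in $\mathcal{D}_{\ge p}(Q_k)$, the probability that the random spanning subgraph of $Q_k$ is connected is at least $P$. Then for all large enough $n$, every model in $\mathcal{D}_{\ge p}(\mathbb{Z}^n)$ percolates. In particular, $$\lim_{n\to\infty} p_{\mathrm{max}}(\mathbb{Z}^n)\le p.$$
   Context: $Q_k$ is the $k$-dimensional hypercube graph with vertex set $\{0,1\}^k$, two vertices being adjacent iff they differ in exactly one coordinate. $\mathbb{Z}^n$ denotes the $n$-dimensional lattice graph: its vertices are the points with integer coordinates, and two vertices are adjacent iff they are at Euclidean distance $1$. A bond percolation model on a (possibly infinite) graph $G$ is a probability distribution on the spanning subgraphs of $G$; an edge is open if it is present in the random subgraph and closed otherwise. The model is 1-independent if, for any two disjoint sets of edges $S_1$, $S_2$ of $G$ such that no edge in $S_1$ shares a vertex with an edge in $S_2$, the states (open or closed) of the edges in $S_1$ are independent of the states of the edges in $S_2$. A model on an infinite graph percolates if the random subgraph has an infinite component with positive probability. $\mathcal{D}_{\ge p}(G)$ is the class of 1-independent bond percolation models on $G$ in which each edge is open with probability at least $p$, and $$p_{\mathrm{max}}(G)=\sup\{p : \text{some model in } \mathcal{D}_{\ge p}(G) \text{ does not percolate}\}.$$ The sequence $p_{\mathrm{max}}(\mathbb{Z}^n)$ is non-increasing in $n$, so the limit exists. *)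

(* Defs.v *)
From HB Require Import structures.
From mathcomp Require Import all_boot all_order all_algebra.
From mathcomp Require Import all_classical all_reals all_analysis.
From Stdlib Require Import Relation_Operators.

Set Implicit Arguments.
Unset Strict Implicit.
Unset Printing Implicit Defensive.

Import Order.TTheory GRing.Theory Num.Theory numFieldNormedType.Exports.

Local Open Scope classical_set_scope.
Local Open Scope ring_scope.

Record graph := Graph {
  vertex :> Type;
  adj : vertex -> vertex -> Prop;
  adj_sym : forall x y, adj x y -> adj y x;
  adj_irrefl : forall x, ~ adj x x }.
Arguments adj : clear implicits.

Definition component (G : graph) (x : G) : set G :=
  [set y | clos_refl_trans G (adj G) x y].

Definition graph_connected (G : graph) : Prop :=
  forall x y : G, component x y.

Definition edge_set (G : graph) : set (set G) :=
  [set e | exists x y, adj G x y /\ e = [set x; y]].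
Arguments edge_set : clear implicits.

Definition edge (G : graph) : Type := set_type (edge_set G).

(* A spanning subgraph of [G] is encoded by its set of (open) edges. *)
Definition spanning (G : graph) : Type := set (edge G).

Section Subgraph.
Variables (G : graph) (w : spanning G).

Definition open_adj (x y : G) : Prop :=
  exists2 e : edge G, w e & set_val e = [set x; y].

Lemma open_adj_sym x y : open_adj x y -> open_adj y x.
Proof. by move=> [e we exy]; exists e => //; rewrite exy setUC. Qed.

Lemma open_adj_irrefl x : ~ open_adj x x.
Proof.
move=> [e _ exx]; have [a [b [ab eab]]] := set_mem (valP e).
have aE : set_val e a by rewrite [set_val e]eab; left.
have bE : set_val e b by rewrite [set_val e]eab; right.
move: aE bE; rewrite exx setUid /= => aE bE.
by apply: (@adj_irrefl G x); move: ab; rewrite aE bE.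
Qed.

Definition subgraph : graph := Graph open_adj_sym open_adj_irrefl.

End Subgraph.

Definition open_event (G : graph) (e : edge G) : set (spanning G) :=
  [set w | w e].

(* The spanning subgraphs with the product sigma-algebra of {0,1}^E(G). *)
Definition configuration (G : graph) :=
  g_sigma_algebraType (@open_event G @` [set: edge G]).

Definition model (R : realType) (G : graph) := probability (configuration G) R.

(* Events depending only on the states of the edges in [S]. *)
Definition events_of (G : graph) (S : set (edge G)) : set (set (spanning G)) :=
  <<s @open_event G @` S >>.

Definition one_independent (R : realType) (G : graph) (mu : model R G) : Prop :=
  forall S1 S2 : set (edge G),
    S1 `&` S2 = set0 ->
    (forall e f, S1 e -> S2 f -> set_val e `&` set_val f = set0) ->
    forall A B, events_of S1 A -> events_of S2 B ->
      mu (A `&` B) = (mu A * mu B)%E.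

Definition D_ge (R : realType) (G : graph) (p : R) : set (model R G) :=
  [set mu | one_independent mu /\
            forall e : edge G, (p%:E <= mu (open_event e))%E].

(* For countable [G], in particular for the lattices below, the event is
   measurable: it is described by countably many finite open paths. *)
Definition percolates (R : realType) (G : graph) (mu : model R G) : Prop :=
  (0 < mu [set w | exists x : subgraph w, infinite_set (component x)])%E.

(* [p] ranges over [0, 1], so that the supremum is always that of a bounded
   set, even when [G] has no edge. *)
Definition p_max (R : realType) (G : graph) : R :=
  sup [set p : R | 0 <= p <= 1 /\
                   exists2 mu : model R G, D_ge p mu & ~ percolates mu].

Section Hypercube.
Variable k : nat.

Definition cube_adj (x y : {ffun 'I_k -> bool}) : Prop :=
  #|[set i | x i != y i]%SET| = 1%N.

Lemma cube_adj_sym x y : cube_adj x y -> cube_adj y x.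
Proof.
rewrite /cube_adj => <-; apply: eq_card => i.
by rewrite !finset.inE eq_sym.
Qed.

Lemma cube_adj_irrefl x : ~ cube_adj x x.
Proof.
by rewrite /cube_adj eq_card0 // => i; rewrite finset.inE eqxx.
Qed.

Definition hypercube : graph := Graph cube_adj_sym cube_adj_irrefl.

End Hypercube.

Section Lattice.
Variables (R : realType) (n : nat).

Definition euclidean_dist (x y : 'rV[int]_n) : R :=
  Num.sqrt (\sum_(i < n) ((x ord0 i)%:~R - (y ord0 i)%:~R) ^+ 2).

Definition lattice_adj (x y : 'rV[int]_n) : Prop := euclidean_dist x y = 1.

Lemma lattice_adj_sym x y : lattice_adj x y -> lattice_adj y x.
Proof.
rewrite /lattice_adj => <-; congr Num.sqrt; apply: eq_bigr => i _.
by rewrite -sqrrN opprB.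
Qed.

Lemma lattice_adj_irrefl x : ~ lattice_adj x x.
Proof.
rewrite /lattice_adj /euclidean_dist big1 => [|i _]; last by rewrite subrr expr0n.
by rewrite sqrtr0 => /esym/eqP; rewrite oner_eq0.
Qed.

Definition lattice : graph := Graph lattice_adj_sym lattice_adj_irrefl.

End Lattice.

Definition golden_ratio (R : realType) : R := (Num.sqrt 5 + 1) / 2.

(* Main.v *)
(** Let [q_j = (1 - p)^(2^j)].  Two adjacent copies of [Q_j] in the lattice are
    joined by [2^j] independent edges, so all of these are closed with
    probability at most [q_j]; hence the probability [P_j] that [Q_j] is connected
    satisfies [P_(j+1) >= P_j^2 - q_j].  The ratio [r_j = P_j / sqrt q_j] thus
    satisfies [r_(j+1) >= r_j^2 - 1], a recursion whose repelling fixed point is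
    the golden ratio: once [r_k] exceeds it, [r_j] tends to infinity, and for some
    [K] a missing link between two copies of [Q_K] is much less likely, even
    relatively, than both copies being connected ("good").

    Copies of [Q_K] are then the sites of a coarser lattice of high dimension.  A
    cell (a point of a quadrant of Z^2) has many candidate hubs, one in each of [L]
    directions, and its first good hub is its representative.  The representatives
    of two adjacent cells are joined by disjoint paths with four interior sites,
    one for each of [m] further directions.  Exploring the hubs and the paths for
    the first good ones uses only events that are independent of the links, so
    adjacent cells are joined with probability as close to 1 as desired.

    It remains to percolate on the quadrant when edges are 1-independent and open
    with probability close to 1.  Group the cells into 2 x 2 blocks, and call a pair
    of adjacent blocks open when its 4 x 2 rectangle contains no two
    vertex-disjoint closed edges.  Then some component contains at least three cells
    of each of the two blocks; as two such triples in a block meet, open paths of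
    blocks yield open paths of cells.  Disjoint edges being independent, the failure
    probability is squared up to a constant at each renormalization, so with
    positive probability all the edges near the origin are open at all scales. *)
Require Import Defs.
From HB Require Import structures.
From mathcomp Require Import all_boot all_order all_algebra.
From mathcomp Require Import all_classical all_reals all_analysis.
From Stdlib Require Import Relation_Operators Operators_Properties.
From mathcomp Require Import zify.
From mathcomp Require Import ring lra.

Set Implicit Arguments.
Unset Strict Implicit.
Unset Printing Implicit Defensive.

Import Order.TTheory GRing.Theory Num.Theory numFieldNormedType.Exports.

Local Open Scope classical_set_scope.
Local Open Scope ring_scope.

(** * Renormalization on the quadrant *)

Notation cell := (nat * nat)%type.

Definition step (d : bool) (s : cell) : cell :=
  if d then (s.1.+1, s.2) else (s.1, s.2.+1).

Definition child (s : cell) (c : bool * bool) : cell :=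
  (s.1.*2 + c.1, s.2.*2 + c.2)%N.

(* The children of [s] and [step d s] form a 4 x 2 rectangle; its points have
   local coordinates [(i, k)], with [i < 4] along the direction [d]. *)
Definition rect_pt (d : bool) (s : cell) (v : nat * nat) : cell :=
  if d then (s.1.*2 + v.1, s.2.*2 + v.2)%N else (s.1.*2 + v.2, s.2.*2 + v.1)%N.

(** A local edge is coded by its lower end and a flag, [true] along the long side; [rect_edge] turns
    this flag into a direction of the quadrant. *)
Definition local_end (e : nat * nat * bool) : nat * nat :=
  if e.2 then (e.1.1.+1, e.1.2) else (e.1.1, e.1.2.+1).

Definition rect_edges : seq (nat * nat * bool) :=
  [seq (v, true) | v <- [:: (0, 0); (1, 0); (2, 0); (0, 1); (1, 1); (2, 1)]]%N ++
  [seq (v, false) | v <- [:: (0, 0); (1, 0); (2, 0); (3, 0)]]%N.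

Definition local_disjoint (e f : nat * nat * bool) : bool :=
  [&& e.1 != f.1, e.1 != local_end f, local_end e != f.1 &
      local_end e != local_end f].

Definition disjoint_pairs : seq ((nat * nat * bool) * (nat * nat * bool)) :=
  [seq ef <- allpairs pair rect_edges rect_edges | local_disjoint ef.1 ef.2].

Definition rect_edge (d : bool) (s : cell) (e : nat * nat * bool) : cell * bool :=
  (rect_pt d s e.1, e.2 == d).

Lemma step_rect d s e :
  step (e.2 == d) (rect_pt d s e.1) = rect_pt d s (local_end e).
Proof. by case: e => [[i k] []]; case: d => //=; rewrite /step /rect_pt /= ?addnS. Qed.

Lemma rect_pt_inj d s : injective (rect_pt d s).
Proof. by case: d => -[i k] [i' k'] [/addnI ? /addnI ?]; congr pair. Qed.

Definition renorm (F : cell -> bool -> Prop) (s : cell) (d : bool) : Prop :=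
  forall ef, ef \in disjoint_pairs ->
    F (rect_edge d s ef.1).1 (rect_edge d s ef.1).2 \/
    F (rect_edge d s ef.2).1 (rect_edge d s ef.2).2.

Definition bool_pairs : seq (bool * bool) :=
  [:: (true, true); (true, false); (false, true); (false, false)].

Definition dominant_root (rc : nat * nat -> seq (nat * nat)) : bool :=
  has (fun r => let S := rc r in
    has (fun m : bool * bool => all (fun c : bool * bool =>
      if c == m then true else (c.1 : nat, c.2 : nat) \in S) bool_pairs) bool_pairs &&
    has (fun m : bool * bool => all (fun c : bool * bool =>
      if c == m then true else ((2 + c.1)%N, c.2 : nat) \in S) bool_pairs) bool_pairs)
  [seq (i, k) | i <- iota 0 4, k <- iota 0 2].

Section Reach.
Variable o : nat * nat * bool -> bool.

Definition grow (S : seq (nat * nat)) : seq (nat * nat) :=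
  undup (S ++ flatten [seq (if o e then
    (if e.1 \in S then [:: local_end e] else [::]) ++
    (if local_end e \in S then [:: e.1] else [::]) else [::]) | e <- rect_edges]).

(** Seven rounds fill a component, since the rectangle has eight points. *)
Definition reach (r : nat * nat) := iter 7 grow [:: r].

Definition rect_open : bool := all (fun ef => o ef.1 || o ef.2) disjoint_pairs.

End Reach.

Fixpoint bitseqs (n : nat) : seq bitseq :=
  if n is n'.+1 then [seq b :: s | b <- [:: true; false], s <- bitseqs n'] else [:: [::]].

Definition of_bits (s : bitseq) (e : nat * nat * bool) : bool :=
  nth false s (index e rect_edges).

Lemma mem_bitseqs n (s : bitseq) : size s = n -> s \in bitseqs n.
Proof.
elim: n s => [|n IHn] [|b s] //= [/IHn hs].
by rewrite cats0 mem_cat; case: b; rewrite (map_f _ hs) ?orbT.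
Qed.

(** Closed edges that pairwise meet form a star, the rectangle having no triangle; without the
    centre of the star, the other seven points are still connected by open edges. The proof simply
    enumerates the 1024 states of the ten edges. *)
Lemma bitseqs_dominant :
  all (fun s => if rect_open (of_bits s) then dominant_root (reach (of_bits s)) else true)
      (bitseqs 10).
Proof. by vm_compute. Qed.

Lemma eq_in_reach o o' r : {in rect_edges, o =1 o'} -> reach o r = reach o' r.
Proof.
move=> oo'; rewrite /reach; elim: 7%N => //= n ->.
rewrite /grow; congr (undup (_ ++ flatten _)).
by apply/eq_in_map => e he; rewrite oo'.
Qed.

Lemma disjoint_pairsP ef : ef \in disjoint_pairs ->
  [/\ ef.1 \in rect_edges, ef.2 \in rect_edges & local_disjoint ef.1 ef.2].
Proof.
rewrite mem_filter => /andP[dis /allpairsP[[e f] [he hf efE]]].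
by move: dis; rewrite efE.
Qed.

Lemma rect_open_dominant o : rect_open o -> dominant_root (reach o).
Proof.
move=> oo; pose s := map o rect_edges.
have os : {in rect_edges, o =1 of_bits s}.
  move=> e he; rewrite /of_bits (nth_map (0, 0, true)%N) ?index_mem //.
  by rewrite nth_index.
have hs : s \in bitseqs 10 by apply: mem_bitseqs; rewrite size_map.
have := allP bitseqs_dominant _ hs.
have -> : rect_open (of_bits s).
  apply/allP => ef hef; have [h1 h2 _] := disjoint_pairsP hef.
  by rewrite -!os //; exact: (allP oo).
have -> // : reach (of_bits s) = reach o.
by apply/funext => r; apply/esym/eq_in_reach.
Qed.

Definition linked (F : cell -> bool -> Prop) : cell -> cell -> Prop :=
  clos_refl_sym_trans cell (fun s s' => exists2 d, F s d & s' = step d s).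

Lemma linked_step F s d : F s d -> linked F s (step d s).
Proof. by move=> Fsd; apply: rst_step; exists d. Qed.

Lemma reach_linked (F : cell -> bool -> Prop) d s (o : nat * nat * bool -> bool) r v :
  (forall e, o e -> F (rect_edge d s e).1 (rect_edge d s e).2) ->
  v \in reach o r -> linked F (rect_pt d s r) (rect_pt d s v).
Proof.
move=> oF; have edgeF e : o e -> linked F (rect_pt d s e.1) (rect_pt d s (local_end e)).
  by move=> /oF Fe; rewrite -step_rect; exact: linked_step.
rewrite /reach; elim: 7%N v => [|n IHn] v /=.
  by rewrite inE => /eqP ->; exact: rst_refl.
rewrite {1}/grow mem_undup mem_cat => /orP[/IHn //|/flattenP[l /mapP[e _ ->]]].
case: ifP => // oe; rewrite mem_cat => /orP[]; case: ifP => // /IHn he; rewrite inE => /eqP ->.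
  by apply: rst_trans he _; exact: edgeF.
by apply: rst_trans he _; apply: rst_sym; exact: edgeF.
Qed.

(** [m] and [m'] are the only children that the component of [r] may miss. *)
Definition child_majority F (s s' : cell) : Prop := exists r m m',
  (forall c, c != m -> linked F r (child s c)) /\
  (forall c, c != m' -> linked F r (child s' c)).

Lemma child_majority_sym F s s' : child_majority F s s' -> child_majority F s' s.
Proof. by move=> [r [m [m' [h h']]]]; exists r, m', m. Qed.

Lemma child_majority_trans F s s' s'' :
  child_majority F s s' -> child_majority F s' s'' -> child_majority F s s''.
Proof.
move=> [r [m [n [hm hn]]]] [r' [m' [n' [hm' hn']]]].
(* Of the four children of [s'], each component misses at most one, so some child lies in both. *)
have [c cn cm'] : exists2 c : bool * bool, c != n & c != m'.
  case: n m' {hn hm'} => [[] []] [[] []];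
    solve [by exists (true, true)|by exists (true, false)
          |by exists (false, true)|by exists (false, false)].
exists r, m, n'; split=> // c' c'n'.
apply: rst_trans (hn _ cn) _; apply: rst_trans (hn' _ c'n').
by apply: rst_sym; exact: hm'.
Qed.

(** Local coordinates put the direction [d] first, hence the swap when [d] is vertical. *)
Definition flip (d : bool) (c : bool * bool) := if d then c else (c.2, c.1).

Lemma flipK d : involutive (flip d).
Proof. by case: d => -[]. Qed.

Lemma child_rect d s c :
  child s c = rect_pt d s ((flip d c).1 : nat, (flip d c).2 : nat).
Proof. by case: d. Qed.

Lemma child_step_rect d s c :
  child (step d s) c = rect_pt d s ((2 + (flip d c).1)%N, (flip d c).2 : nat).
Proof.
by case: d; rewrite /child /step /rect_pt /= doubleS ?add2n ?add1n !addSn !addnS.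
Qed.

Lemma renorm_majority F s d : renorm F s d -> child_majority F s (step d s).
Proof.
move=> rF; pose o e := `[< F (rect_edge d s e).1 (rect_edge d s e).2 >].
have /rect_open_dominant : rect_open o.
  by apply/allP => ef /rF; rewrite /o => -[] /asboolP ->; rewrite ?orbT.
have oF e : o e -> F (rect_edge d s e).1 (rect_edge d s e).2 by move/asboolP.
have mem_bb (c : bool * bool) :
    c \in bool_pairs.
  by case: c => [[] []].
case/hasP => r _ /andP[/hasP[m _ /allP h] /hasP[m' _ /allP h']].
exists (rect_pt d s r), (flip d m), (flip d m'); split=> c cm.
- rewrite (child_rect d); apply: (reach_linked oF); have := h (flip d c) (mem_bb _).
  by rewrite -(inj_eq (inv_inj (@flipK d))) flipK (negbTE cm).
- rewrite child_step_rect; apply: (reach_linked oF); have := h' (flip d c) (mem_bb _).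
  by rewrite -(inj_eq (inv_inj (@flipK d))) flipK (negbTE cm).
Qed.

Lemma linked_renorm F s s' :
  linked (renorm F) s s' -> s = s' \/ child_majority F s s'.
Proof.
elim=> {s s'} [s s' [d rF ->]|s|s s' _ [->|h]|s s' s'' _ [->|h] _ [<-|h']].
- by right; exact: renorm_majority.
- by left.
- by left.
- by right; exact: child_majority_sym.
- by left.
- by right.
- by right.
- by right; exact: child_majority_trans h h'.
Qed.

Lemma linked_unbounded (F : cell -> bool -> Prop) :
  (forall j e, e \in rect_edges ->
     iter j renorm F (rect_edge true (0, 0)%N e).1 (rect_edge true (0, 0)%N e).2) ->
  forall i, exists2 s : cell, (2 ^ i <= s.1)%N & linked F (0, 0)%N s.
Proof.
(* All scales are treated at once: abscissa [2 ^ i] at scale [j.+1] yields abscissa [2 ^ i.+1] at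
   scale [j], because children double the coordinates. *)
move=> FO i; suff: forall j, exists2 s : cell,
    (2 ^ i <= s.1)%N & linked (iter j renorm F) (0, 0)%N s.
  exact: (fun h => h 0%N).
elim: i => [|i IHi] j.
  exists (1, 0)%N => //; apply: (@linked_step _ _ true).
  exact: (FO j (0, 0, true)%N).
have [s ls] := IHi j.+1; rewrite iterS => /linked_renorm[s0|].
  by move: ls; rewrite -s0 leqn0 expn_eq0.
move=> [r [m [m' [h h']]]].
have [c cm] : exists c : bool * bool, c != m.
  by exists (~~ m.1, m.2); case: (m) => [[] []].
have [c' cm'] : exists c : bool * bool, c != m'.
  by exists (~~ m'.1, m'.2); case: (m') => [[] []].
exists (child s c').
  by rewrite expnS mul2n (leq_trans _ (leq_addr _ _)) // leq_double.
apply: rst_trans (h' _ cm'); apply: rst_trans (rst_sym _ _ _ _ (h _ cm)).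
have L e : e \in rect_edges ->
    linked (iter j renorm F) (rect_pt true (0, 0)%N e.1)
      (rect_pt true (0, 0)%N (local_end e)).
  by move=> he; rewrite -(step_rect true); apply: linked_step; exact: FO.
(* These three edges form a spanning tree of the four children of the origin, one of which is the
   origin of the finer scale. *)
have L00 := L (0, 0, true)%N isT; have L01 := L (0, 0, false)%N isT.
have L10 := L (1, 0, false)%N isT.
move: L00 L01 L10; rewrite /rect_pt /child /= !add0n => L00 L01 L10.
by case: c {cm} => [[] []];
  [exact: (rst_trans _ _ _ _ _ L00 L10)|exact: L00|exact: L01|exact: rst_refl].
Qed.

(** * Events depending on the edges inside a vertex set *)

(** Events are localized by vertex sets because 1-independence then only asks these sets to be
    disjoint. *)
Definition ev (G : graph) (U : set G) : set (set (spanning G)) :=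
  events_of [set e : edge G | set_val e `<=` U].

Section EventAlgebra.
Variables (G : graph) (U : set G).
Implicit Types A B : set (spanning G).

Lemma evC A : ev U A -> ev U (~` A).
Proof. by rewrite -setTD; exact: sigma_algebraCD. Qed.

Lemma ev_bigcup (I : countType) (F : I -> set (spanning G)) :
  (forall i, ev U (F i)) -> ev U (\bigcup_i F i).
Proof.
move=> UF; pose F' n := if unpickle n is Some i then F i else set0.
have -> : \bigcup_i F i = \bigcup_n F' n.
  apply/seteqP; split=> [w [i _ Fi]|w [n _]].
    by exists (pickle i) => //; rewrite /F' pickleK.
  by rewrite /F'; case: (unpickle n) => // i Fi; exists i.
apply: sigma_algebra_bigcup => n; rewrite /F'; case: (unpickle n) => //.
exact: sigma_algebra0.
Qed.

Lemma evU A B : ev U A -> ev U B -> ev U (A `|` B).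
Proof.
move=> UA UB; have -> : A `|` B = \bigcup_b (if b then A else B).
  apply/seteqP; split=> [w [] ?|w [[] _ ?]]; [by exists true|by exists false|by left|by right].
by apply: ev_bigcup => -[].
Qed.

Lemma evI A B : ev U A -> ev U B -> ev U (A `&` B).
Proof.
by move=> UA UB; rewrite -[A `&` B]setCK setCI; exact: evC (evU (evC UA) (evC UB)).
Qed.

Lemma ev_exists (I : countType) (F : I -> spanning G -> Prop) :
  (forall i, ev U [set w | F i w]) -> ev U [set w | exists i, F i w].
Proof.
move=> UF; have -> : [set w | exists i, F i w] = \bigcup_i [set w | F i w].
  by apply/seteqP; split=> [w [i Fi]|w [i _ Fi]]; exists i.
exact: ev_bigcup.
Qed.

Lemma ev_forall (I : countType) (F : I -> spanning G -> Prop) :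
  (forall i, ev U [set w | F i w]) -> ev U [set w | forall i, F i w].
Proof.
move=> UF; have -> : [set w | forall i, F i w] = ~` [set w | exists i, ~ F i w].
  apply/seteqP; split=> [w h [i]|w h i]; first exact.
  by apply: contrapT => Fi; apply: h; exists i.
exact: (evC (ev_exists (fun i => evC (UF i)))).
Qed.

Lemma ev_cst (Q : Prop) : ev U [set w | Q].
Proof.
case: (pselect Q) => q.
  have -> : [set w : spanning G | Q] = ~` set0 by apply/seteqP; split=> w // _ [].
  by apply: evC; exact: sigma_algebra0.
have -> : [set w : spanning G | Q] = set0 by apply/seteqP; split=> w // /q.
exact: sigma_algebra0.
Qed.

Lemma ev_imply (Q : Prop) (P : spanning G -> Prop) :
  (Q -> ev U [set w | P w]) -> ev U [set w | Q -> P w].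
Proof.
move=> UP; case: (pselect Q) => q.
  have -> : [set w : spanning G | Q -> P w] = [set w | P w].
    by apply/seteqP; split=> w /= h; [exact: h|move=> _].
  exact: UP.
have -> : [set w : spanning G | Q -> P w] = [set w | True].
  by apply/seteqP; split=> w //= _ /q.
exact: ev_cst.
Qed.

Lemma ev_and (Q : Prop) (P : spanning G -> Prop) :
  (Q -> ev U [set w | P w]) -> ev U [set w | Q /\ P w].
Proof.
move=> UP; case: (pselect Q) => q; first by apply: evI; [exact: ev_cst|exact: UP].
have -> : [set w : spanning G | Q /\ P w] = [set w | False].
  by apply/seteqP; split=> w // [/q].
exact: ev_cst.
Qed.

Lemma ev_open (e : edge G) : set_val e `<=` U -> ev U (open_event e).
Proof. by move=> eU; apply: sub_sigma_algebra; exists e. Qed.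

Lemma ev_sub (V : set G) A : V `<=` U -> ev V A -> ev U A.
Proof.
move=> VU; apply: sub_sigma_algebra2 => _ [e eV <-].
by exists e => //= x /eV /VU.
Qed.

End EventAlgebra.

Lemma ev_measurable (G : graph) (U : set G) (A : set (spanning G)) :
  ev U A -> measurable (A : set (configuration G)).
Proof. by apply: sub_sigma_algebra2 => _ [e _ <-]; exists e. Qed.

(** * Real-valued probabilities and independence *)

Section Pr.
Variables (R : realType) (G : graph) (mu : model R G).
Implicit Types A B T : set (spanning G).

Definition Pr A : R := fine (mu A).

Lemma PrE U A : ev U A -> mu A = (Pr A)%:E.
Proof.
move=> /ev_measurable mA; rewrite fineK // ge0_fin_numE //.
by rewrite (le_lt_trans (probability_le1 mu mA)) // ltry.
Qed.

Lemma Pr_ge0 A : 0 <= Pr A.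
Proof. by rewrite fine_ge0. Qed.

Lemma Pr_le1 U A : ev U A -> Pr A <= 1.
Proof.
move=> UA; rewrite -lee_fin -(PrE UA); apply: probability_le1.
exact: ev_measurable UA.
Qed.

Lemma PrT : Pr setT = 1.
Proof. by rewrite /Pr probability_setT. Qed.

Lemma Pr_le U V A B : ev U A -> ev V B -> A `<=` B -> Pr A <= Pr B.
Proof.
move=> UA VB AB; rewrite -lee_fin -(PrE UA) -(PrE VB).
apply: le_measure => //; rewrite inE; [exact: ev_measurable UA|exact: ev_measurable VB].
Qed.

Lemma PrU_le U V A B : ev U A -> ev V B -> Pr (A `|` B) <= Pr A + Pr B.
Proof.
move=> UA VB.
have [TA TB] := (ev_sub (@subsetT _ U) UA, ev_sub (@subsetT _ V) VB).
rewrite -lee_fin EFinD -(PrE TA) -(PrE TB) -(PrE (evU TA TB)).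
by apply: measureU2; [exact: ev_measurable UA|exact: ev_measurable VB].
Qed.

Lemma Pr_split U V A B : ev U A -> ev V B ->
  Pr A = Pr (A `&` B) + Pr (A `&` ~` B).
Proof.
move=> UA VB.
have [TA TB] := (ev_sub (@subsetT _ U) UA, ev_sub (@subsetT _ V) VB).
apply: EFin_inj; rewrite EFinD -(PrE TA) -(PrE (evI TA TB)) -(PrE (evI TA (evC TB))).
by rewrite addeC -setDE; apply: measureDI; [exact: ev_measurable UA|exact: ev_measurable VB].
Qed.

Lemma PrC U A : ev U A -> Pr (~` A) = 1 - Pr A.
Proof.
move=> UA; have TT : ev U [set: spanning G] by exact: ev_cst U True.
have := Pr_split TT UA; rewrite !setTI PrT => ->.
by rewrite addrAC subrr add0r.
Qed.

Lemma Pr_indep U V A B : one_independent mu -> U `&` V = set0 ->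
  ev U A -> ev V B -> Pr (A `&` B) = Pr A * Pr B.
Proof.
move=> ind UV UA VB.
have disj (e f : edge G) : set_val e `<=` U -> set_val f `<=` V ->
    set_val e `&` set_val f = set0.
  move=> eU fV; apply/seteqP; split=> // x [ex fx].
  by have : (U `&` V) x by [split; [exact: eU|exact: fV]]; rewrite UV.
have nonempty (e : edge G) : exists x, set_val e x.
  by have [x [y [_ exy]]] := set_mem (valP e); exists x; rewrite [set_val e]exy; left.
(* An edge inside both [U] and [V] would be disjoint from itself, hence empty. *)
have S0 : [set e : edge G | set_val e `<=` U] `&` [set e : edge G | set_val e `<=` V] = set0.
  apply/seteqP; split=> // e [eU eV]; have [x ex] := nonempty e.
  by have := disj _ _ eU eV; rewrite setIid => e0; move: ex; rewrite e0.
have h := ind _ _ S0 disj A B UA VB.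
have [TA TB] := (ev_sub (@subsetT _ U) UA, ev_sub (@subsetT _ V) VB).
apply: EFin_inj; rewrite EFinM -(PrE TA) -(PrE TB) -(PrE (evI TA TB)).
exact: h.
Qed.

End Pr.

(** * Measurability of connectivity events *)

Section Connectivity.
Variables (G : graph) (w : spanning G).

Lemma component_trans y x z : component (G := subgraph w) x y ->
  component (G := subgraph w) y z -> component (G := subgraph w) x z.
Proof. by move=> xy yz; exact: rt_trans xy yz. Qed.

Lemma component_sym x y : component (G := subgraph w) x y ->
  component (G := subgraph w) y x.
Proof.
rewrite /component /=; elim=> [u v uv|u|u v z _ vu _ zv].
- by apply: rt_step; exact: open_adj_sym.
- exact: rt_refl.
- exact: rt_trans zv vu.
Qed.

End Connectivity.

Lemma ev_adj (G : graph) (U : set G) (x y : G) : U x -> U y ->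
  ev U [set w : spanning G | open_adj w x y].
Proof.
move=> Ux Uy; case: (pselect (edge_set G [set x; y])) => [exy|nxy].
  pose e : edge G := exist _ [set x; y] (mem_set exy).
  have -> : [set w : spanning G | open_adj w x y] = open_event e.
    apply/seteqP; split=> [w [e' we' e'E]|w we]; last by exists e.
    by have <- : e' = e by apply: val_inj.
  by apply: ev_open => z [] ->.
have -> : [set w : spanning G | open_adj w x y] = set0.
  by apply/seteqP; split=> // w [e _ exy]; apply: nxy; rewrite -exy; exact: set_mem (valP e).
exact: sigma_algebra0.
Qed.

Section MeasurableConnectivity.
Variables (G : graph) (V : countType) (f : V -> G) (g : G -> V).
Hypotheses (gK : cancel g f) (fK : cancel f g).

(** Connection is a countable union over the finite vertex lists that can code an open path. *)
Lemma ev_component (x y : G) : ev setT [set w | component (G := subgraph w) x y].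
Proof.
pose path_to w (y : G) := fix path_to (x : G) (s : seq V) : Prop :=
  if s is v :: s' then open_adj w x (f v) /\ path_to (f v) s' else x = y.
have -> : [set w | component (G := subgraph w) x y] = [set w | exists s, path_to w y x s].
  apply/seteqP; split=> w /=.
    move=> /(@clos_rt_rt1n _ _ _ _); elim=> [u|u v z uv _ [s hs]]; first by exists [::].
    by exists (g v :: s); rewrite /= gK.
  move=> [s]; elim: s x => [|v s IHs] x /=; first by move=> ->; exact: rt_refl.
  by move=> [xv /IHs]; apply: rt_trans; exact: rt_step.
apply: ev_exists => s; elim: s x => [|v s IHs] x /=; first exact: ev_cst.
by apply: evI; [exact: ev_adj|exact: IHs].
Qed.

Lemma ev_graph_connected : ev setT [set w : spanning G | graph_connected (subgraph w)].
Proof.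
have -> : [set w : spanning G | graph_connected (subgraph w)] =
    [set w | forall u v : V, component (G := subgraph w) (f u) (f v)].
  apply/seteqP; split=> w h; first by move=> u v; exact: h.
  by move=> x y; rewrite -(gK x) -(gK y); exact: h.
by apply: ev_forall => u; apply: ev_forall => v; exact: ev_component.
Qed.

Lemma ev_infinite_component :
  ev setT [set w : spanning G | exists x : subgraph w, infinite_set (component x)].
Proof.
(* A set is infinite when no finite list exhausts it, which leaves only countable quantifiers. *)
have -> : [set w : spanning G | exists x : subgraph w, infinite_set (component x)] =
    [set w | exists v : V, forall s : seq V, exists u : V,
      u \notin s /\ component (G := subgraph w) (f v) (f u)].
  apply/seteqP; split=> w /=.
    move=> [x xinf]; exists (g x) => s; apply: contrapT => h; apply: xinf.
    apply: (@sub_finite_set _ _ (f @` [set` s])).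
      move=> y xy; exists (g y); last by rewrite gK.
      apply: contrapT => ys; apply: h; exists (g y).
      by split; [apply/negP|rewrite !gK].
    exact/finite_image/finite_seq.
  move=> [v h]; exists (f v) => fin.
  have /finite_seqP[s sE] : finite_set (g @` component (G := subgraph w) (f v)).
    exact: finite_image.
  have [u [us vu]] := h s; move/negP: us; apply.
  suff : [set` s] u by [].
  by rewrite -sE; exists (f u).
apply: ev_exists => v; apply: ev_forall => s; apply: ev_exists => u.
by apply: evI; [exact: ev_cst|exact: ev_component].
Qed.

End MeasurableConnectivity.

(** * Restriction of a model along a graph embedding *)

Section Pullback.
Variables (R : realType) (G H : graph) (phi : G -> H).
Hypotheses (phi_inj : injective phi)
  (phi_adj : forall x y, adj G x y -> adj H (phi x) (phi y)).

Lemma image_edge (e : edge G) : edge_set H (phi @` set_val e).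
Proof.
have [x [y [xy exy]]] := set_mem (valP e).
exists (phi x), (phi y); split; first exact: phi_adj.
by rewrite [set_val e]exy image_setU !image_set1.
Qed.

Definition edge_map (e : edge G) : edge H :=
  exist _ (phi @` set_val e) (mem_set (image_edge e)).

Definition pull (w : configuration H) : configuration G := [set e | w (edge_map e)].

(** The sets whose preimage lies in the target sigma-algebra form a sigma-algebra that contains the
    generators. *)
Lemma events_of_pull (S : set (edge G)) (A : set (spanning G)) :
  events_of S A -> events_of (edge_map @` S) (pull @^-1` A).
Proof.
pose T := <<s @open_event H @` (edge_map @` S) >>.
have := @sigma_algebra_image (spanning H) (spanning G) setT pull T
  (@smallest_sigma_algebra _ _ _).
move=> sT SA; have := SA (image_set_system setT pull T); rewrite /image_set_system /= setTI.
apply; split=> // _ [e Se <-] /=; rewrite setTI; apply: sub_sigma_algebra.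
by exists (edge_map e) => //; exists e.
Qed.

Lemma ev_pull (U : set G) (A : set (spanning G)) :
  ev U A -> ev (phi @` U) (pull @^-1` A).
Proof.
move=> /events_of_pull; apply: sub_sigma_algebra2 => _ [_ [e eU <-] <-].
by exists (edge_map e) => // _ [x ex <-]; exists x => //; exact: eU.
Qed.

Lemma measurable_pull : measurable_fun setT pull.
Proof.
move=> _ A mA; rewrite setTI.
have UA : ev setT A.
  by apply: sub_sigma_algebra2 mA => _ [e _ <-]; exists e.
exact: ev_measurable (ev_pull UA).
Qed.

HB.instance Definition _ := isMeasurableFun.Build _ _ _ _ pull measurable_pull.

Definition pull_model (mu : model R H) : model R G := distribution mu pull.

(** Injectivity of [phi] keeps the two edge sets disjoint and without common vertex in [H]. *)
Lemma pull_one_independent (mu : model R H) :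
  one_independent mu -> one_independent (pull_model mu).
Proof.
move=> ind S1 S2 S12 dis A B SA SB.
apply: (ind (edge_map @` S1) (edge_map @` S2)).
- apply/seteqP; split=> // _ [[e Se <-] [f Sf]] /(congr1 val) /=.
  move=> fe; have {}fe : f = e.
    apply: val_inj; apply/seteqP; split=> z; rewrite -2!(image_inj phi_inj).
      by rewrite [X in X (phi z) -> _]fe.
    by rewrite -[X in X (phi z) -> _]fe.
  by have : (S1 `&` S2) e by [split=> //; rewrite -fe]; rewrite S12.
- move=> _ _ [e Se <-] [f Sf <-]; apply/seteqP; split=> // _ [[x ex <-] [y fy]] /phi_inj yx.
  by have : (set_val e `&` set_val f) x by [split=> //; rewrite -yx]; rewrite dis.
- exact: events_of_pull.
- exact: events_of_pull.
Qed.

Lemma pull_D_ge (p : R) (mu : model R H) : D_ge p mu -> D_ge p (pull_model mu).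
Proof.
move=> [ind mup]; split; first exact: pull_one_independent.
by move=> e; exact: mup.
Qed.

Lemma pull_component w x y : component (G := subgraph (pull w)) x y ->
  component (G := subgraph w) (phi x) (phi y).
Proof.
rewrite /component /=; elim=> [u v [e we euv]|u|u v z _ uv _ vz].
- apply: rt_step; exists (edge_map e) => //=.
  rewrite -[set_val _]/(phi @` set_val e) euv.
  by rewrite image_setU !image_set1.
- exact: rt_refl.
- exact: rt_trans uv vz.
Qed.

Lemma pull_infinite w : (exists x : subgraph (pull w), infinite_set (component x)) ->
  exists x : subgraph w, infinite_set (component x).
Proof.
move=> [x xinf]; exists (phi x) => fin; apply: xinf.
apply: (@sub_finite_set _ _ (phi @^-1` component (G := subgraph w) (phi x))).
  by move=> y; exact: pull_component.
by apply: finite_preimage fin => u v _ _; exact: phi_inj.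
Qed.

End Pullback.

(** * Multiscale estimate *)

Lemma Pr_exists_le (R : realType) (G : graph) (mu : model R G) (I : countType)
    (s : seq I) (A : I -> spanning G -> Prop) (b : R) :
  (forall i, i \in s -> ev setT [set w | A i w]) ->
  (forall i, i \in s -> Pr mu [set w | A i w] <= b) ->
  Pr mu [set w | exists2 i, i \in s & A i w] <= (size s)%:R * b.
Proof.
elim: s => [|i s IHs] TA sb.
  have -> : [set w | exists2 i : I, i \in [::] & A i w] = set0.
    by apply/seteqP; split=> // w [].
  by rewrite /Pr measure0 mul0r.
have -> : [set w | exists2 j : I, j \in i :: s & A j w] =
    [set w | A i w] `|` [set w | exists2 j : I, j \in s & A j w].
  apply/seteqP; split=> w.
    move=> [j]; rewrite inE => /orP[/eqP -> Ai|js Aj]; first by left.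
    by right; exists j.
  case=> [Ai|[j js Aj]]; first by exists i => //; rewrite inE eqxx.
  by exists j => //; rewrite inE js orbT.
have TE : ev setT [set w | exists2 j : I, j \in s & A j w].
  have -> : [set w | exists2 j : I, j \in s & A j w] =
      [set w | exists j : I, j \in s /\ A j w].
    by apply/seteqP; split=> w [j]; [exists j|case=> js Aj; exists j].
  by apply: ev_exists => j; apply: ev_and => js; apply: TA; rewrite inE js orbT.
apply: (le_trans (PrU_le mu (TA i (mem_head _ _)) TE)).
rewrite /= -natr1 mulrDl mul1r addrC lerD //; last by apply: sb; rewrite inE eqxx.
by apply: IHs => j js; [apply: TA|apply: sb]; rewrite inE js orbT.
Qed.

Section Multiscale.
Variables (R : realType) (G : graph) (mu : model R G) (reg0 : cell -> set G)
  (E0 : cell -> bool -> spanning G -> Prop) (b0 : R).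
Hypotheses (b0_gt0 : 0 < b0) (b0_small : 2000 * b0 <= 1) (mu_indep : one_independent mu)
  (reg0_disj : forall s s' x, reg0 s x -> reg0 s' x -> s = s')
  (ev_E0 : forall s d, ev (reg0 s `|` reg0 (step d s)) [set w | E0 s d w])
  (Pr_E0 : forall s d, Pr mu [set w | ~ E0 s d w] <= b0).

(** The vertices below a cell of scale [j]. An edge depends only on the regions of its two ends, so
    vertex-disjoint edges remain independent at every scale. *)
Fixpoint reg (j : nat) (s : cell) : set G :=
  if j is j'.+1 then [set x | exists c, reg j' (child s c) x] else reg0 s.

Lemma child_inj s s' c c' : child s c = child s' c' -> s = s'.
Proof.
case: s s' => [s1 s2] [s1' s2'] [] /(congr1 half) + /(congr1 half).
by rewrite ![(_.*2 + _)%N]addnC !half_bit_double => -> ->.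
Qed.

Lemma reg_disj j s s' x : reg j s x -> reg j s' x -> s = s'.
Proof.
elim: j s s' => [|j IHj] s s' /=; first exact: reg0_disj.
by move=> [c sx] [c' s'x]; apply: child_inj (IHj _ _ sx s'x).
Qed.

Lemma reg_rect j d s v : (v.1 < 4)%N -> (v.2 < 2)%N ->
  reg j (rect_pt d s v) `<=` reg j.+1 s `|` reg j.+1 (step d s).
Proof.
case: v => i k /= i4 k2 x vx.
have kE : k = (k == 1)%N :> nat by case: k k2 {vx} => [|[]].
have [i2|i2] := ltnP i 2.
  left; exists (flip d (i == 1, k == 1)%N); rewrite (child_rect d) flipK /= -kE.
  by have -> : ((i == 1)%N : nat) = i by case: i i2 {i4 vx} => [|[]].
right; exists (flip d (i == 3, k == 1)%N); rewrite child_step_rect flipK /= -kE.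
by have -> : (2 + ((i == 3)%N : nat))%N = i by case: i i2 i4 {vx} => [|[|[|[]]]].
Qed.

Definition openj (j : nat) (s : cell) (d : bool) (w : spanning G) : Prop :=
  iter j renorm (fun s d => E0 s d w) s d.

Lemma rect_edges_bound e : e \in rect_edges ->
  [/\ (e.1.1 < 4)%N, (e.1.2 < 2)%N, ((local_end e).1 < 4)%N & ((local_end e).2 < 2)%N].
Proof.
have : all (fun e => [&& e.1.1 < 4, e.1.2 < 2, (local_end e).1 < 4 & (local_end e).2 < 2]%N)
  rect_edges by [].
by move=> /allP h /h /and4P.
Qed.

Definition edge_reg j (d : bool) s e : set G :=
  reg j (rect_pt d s e.1) `|` reg j (rect_pt d s (local_end e)).

Lemma ev_openj_aux j (d : bool) s e :
  (forall s d, ev (reg j s `|` reg j (step d s)) [set w | openj j s d w]) ->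
  ev (edge_reg j d s e) [set w | openj j (rect_edge d s e).1 (rect_edge d s e).2 w].
Proof. by move=> /(_ (rect_edge d s e).1 (rect_edge d s e).2); rewrite /= step_rect. Qed.

Lemma ev_openj j s d : ev (reg j s `|` reg j (step d s)) [set w | openj j s d w].
Proof.
elim: j s d => [|j IHj] s d; first exact: ev_E0.
have sub e : e \in rect_edges -> edge_reg j d s e `<=` reg j.+1 s `|` reg j.+1 (step d s).
  by move=> /rect_edges_bound[? ? ? ?] x []; apply: reg_rect.
apply: ev_forall => ef; apply: ev_imply => /disjoint_pairsP[he hf _].
by apply: evU; [apply: ev_sub (sub _ he) _|apply: ev_sub (sub _ hf) _]; exact: ev_openj_aux.
Qed.

Lemma edge_reg_disj j d s e f : local_disjoint e f ->
  edge_reg j d s e `&` edge_reg j d s f = set0.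
Proof.
move=> /and4P[h1 h2 h3 h4]; apply/seteqP; split=> // x.
by case=> -[] hx [] /(reg_disj hx) /rect_pt_inj xx; move: h1 h2 h3 h4; rewrite xx eqxx.
Qed.

(** A renormalized edge fails only if two disjoint edges of the finer scale both fail, so a bound
    [b] becomes at most [100 * b ^+ 2], which is below [b / 2]. *)
Lemma Pr_openj j s d : Pr mu [set w | ~ openj j s d w] <= b0 / 2 ^+ j.
Proof.
elim: j s d => [|j IHj] s d; first by rewrite expr0 divr1; exact: Pr_E0.
pose C e w := ~ openj j (rect_edge d s e).1 (rect_edge d s e).2 w.
have evC' e : ev (edge_reg j d s e) [set w | C e w].
  by apply: evC; apply: ev_openj_aux => s' d'; exact: ev_openj.
have TC e : ev setT [set w | C e w] by exact: ev_sub (@subsetT _ _) (evC' e).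
have -> : [set w | ~ openj j.+1 s d w] =
    [set w | exists2 ef, ef \in disjoint_pairs & C ef.1 w /\ C ef.2 w].
  apply/seteqP; split=> w /=.
    move=> /existsNP[ef /not_implyP[hef /not_orP[h1 h2]]]; exists ef => //.
  by move=> [ef hef [h1 h2]] /(_ ef hef) [].
set b := b0 / 2 ^+ j.
have b_gt0 : 0 < b by rewrite divr_gt0 // exprn_gt0.
have h := @Pr_exists_le R G mu _ disjoint_pairs (fun ef w => C ef.1 w /\ C ef.2 w) (b * b).
apply: (le_trans (h _ _)) => [ef _|ef /disjoint_pairsP[_ _ dis]|].
- exact: evI (TC _) (TC _).
- rewrite (Pr_indep mu_indep (edge_reg_disj j d s dis) (evC' _) (evC' _)).
  by apply: ler_pM; rewrite ?Pr_ge0 //; exact: IHj.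
have bb0 : b <= b0.
  by rewrite ler_pdivrMr ?exprn_gt0 // ler_peMr ?(ltW b0_gt0) // exprn_ege1 // ler1n.
have -> : b0 / 2 ^+ j.+1 = b / 2 by rewrite exprSr invfM mulrA.
(* Ten edges give at most 100 ordered pairs. *)
have n100 : (size disjoint_pairs)%:R <= 100 :> R by rewrite ler_nat.
move: (size _)%:R n100 => n n100; rewrite mulrA [b / 2]mulrC ler_wpM2r ?(ltW b_gt0) //.
apply: (@le_trans _ _ (100 * b)); first by rewrite ler_wpM2r ?(ltW b_gt0).
apply: (@le_trans _ _ (100 * b0)); first by rewrite ler_wpM2l.
by move: b0_small; lra.
Qed.

Definition all_open (w : spanning G) : Prop :=
  forall j e, e \in rect_edges ->
    openj j (rect_edge true (0, 0)%N e).1 (rect_edge true (0, 0)%N e).2 w.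

Lemma Pr_all_open : ev setT [set w | all_open w] /\ 0 < Pr mu [set w | all_open w].
Proof.
pose C j e w := ~ openj j (rect_edge true (0, 0)%N e).1 (rect_edge true (0, 0)%N e).2 w.
have TO j e : ev setT
    [set w | openj j (rect_edge true (0, 0)%N e).1 (rect_edge true (0, 0)%N e).2 w].
  have h := @ev_openj j (rect_edge true (0, 0)%N e).1 (rect_edge true (0, 0)%N e).2.
  exact: ev_sub h.
have TA : ev setT [set w | all_open w].
  by apply: ev_forall => j; apply: ev_forall => e; apply: ev_imply => _; exact: TO.
split=> //.
pose B j := [set w | exists2 e, e \in rect_edges & C j e w].
have TB j : ev setT (B j).
  have -> : B j = ~` [set w | forall e, e \in rect_edges ->
      openj j (rect_edge true (0, 0)%N e).1 (rect_edge true (0, 0)%N e).2 w].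
    apply/seteqP; split=> w /=; first by move=> [e he h] /(_ e he).
    by move=> /existsNP[e /not_implyP[he h]]; exists e.
  by apply: evC; apply: ev_forall => e; apply: ev_imply => _; exact: TO.
(* The ten edges contribute [10 * b0 / 2 ^+ j], where [b0] is at most 1/2000; in this form the
   bounds sum to at most [100^-1] over all scales. *)
have PB j : Pr mu (B j) <= 100^-1 / (2 ^ j.+1)%:R.
  apply: (le_trans (@Pr_exists_le R G mu _ rect_edges (C j) (b0 / 2 ^+ j) _ _)).
  - by move=> e _; apply: evC; exact: TO.
  - by move=> e _; exact: Pr_openj.
  rewrite natrX exprSr invfM mulrA -[_%:R]/(10 : R).
  have : 0 < (2 ^+ j)^-1 :> R by rewrite invr_gt0 exprn_gt0.
  move: (_^-1) => t t0; have : 2000 * b0 * t <= 1 * t by rewrite ler_wpM2r // ltW.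
  lra.
have UB : [set w | all_open w] = ~` \bigcup_j B j.
  apply/seteqP; split=> w /=; first by move=> h [j _ [e he]]; apply; exact: h.
  by move=> h j e he; apply: contrapT => o; apply: h; exists j => //; exists e.
have TU : ev setT (\bigcup_j B j) by exact: sigma_algebra_bigcup.
rewrite UB (PrC mu TU) subr_gt0 -lte_fin -(PrE mu TU).
have le1 : (mu (\bigcup_j B j) <= \sum_(0 <= j <oo) mu (B j))%E.
  apply: measure_sigma_subadditive => //.
  - by move=> j; exact: ev_measurable (TB j).
  - exact: ev_measurable TU.
apply: (le_lt_trans le1).
apply: (@le_lt_trans _ _ (\sum_(0 <= j <oo) (100^-1 / (2 ^ j.+1)%:R)%:E)%E).
  by apply: lee_nneseries => // j _; rewrite (PrE mu (TB j)) lee_fin.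
apply: (@le_lt_trans _ _ (100^-1)%:E); last by rewrite lte_fin; lra.
by apply: (@epsilon_trick0 R _ xpredT).
Qed.

End Multiscale.

(** * Blocks *)

Section Blocks.
Variables (R : realType) (n : nat).
Notation Zn := (lattice R n).
Implicit Types (x y : 'rV[int]_n).

(* Zero when [n <= c]. *)
Definition unit_row (c : nat) : 'rV[int]_n := \row_i ((i == c :> nat)%:R).
Local Notation e := unit_row.

Lemma shiftE x c (i : 'I_n) : (x + e c) ord0 i = x ord0 i + (i == c :> nat)%:R.
Proof. by rewrite !mxE. Qed.

Lemma dist1P x y (i : 'I_n) : `|x ord0 i - y ord0 i| = 1 ->
  (forall j, j != i -> x ord0 j = y ord0 j) -> lattice_adj R x y.
Proof.
move=> xyi xyj; rewrite /lattice_adj /euclidean_dist (bigD1 i) //= big1 => [|j ji].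
  by rewrite -rmorphB /= -real_normK ?num_real // -intr_norm xyi expr1n addr0 sqrtr1.
by rewrite xyj // subrr expr0n.
Qed.

Lemma adj_shift x c : (c < n)%N -> adj Zn x (x + e c).
Proof.
move=> cn; apply: (@dist1P _ _ (Ordinal cn)) => [|j jc]; rewrite shiftE.
  by rewrite eqxx opprD addrA subrr sub0r normrN normr1.
by rewrite (_ : (j == c :> nat) = false) ?addr0 //; apply/negbTE; apply: contra jc.
Qed.

(** It contains the [j]-dimensional cube based at [x] and is unrestricted in the directions of that
    cube, so two cylinders are disjoint as soon as one coordinate from [j] on differs. *)
Definition cyl (j : nat) x : set Zn :=
  [set y : 'rV[int]_n | forall i : 'I_n, (j <= i)%N -> y ord0 i = x ord0 i].

Lemma cyl_le j j' x : (j <= j')%N -> cyl j x `<=` cyl j' x.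
Proof. by move=> jj' y h i j'i; apply: h; apply: leq_trans j'i. Qed.

Lemma cyl_shift j c x : (c < j)%N -> cyl j (x + e c) `<=` cyl j x.
Proof.
move=> cj y h i ji; rewrite h // shiftE (_ : (i == c :> nat) = false) ?addr0 //.
by apply/negbTE; rewrite neq_ltn (leq_trans cj ji) orbT.
Qed.

Lemma cyl_disj j x y (i : 'I_n) : (j <= i)%N -> x ord0 i <> y ord0 i ->
  cyl j x `&` cyl j y = set0.
Proof.
move=> ji xy; apply/seteqP; split=> // z [/(_ i ji) zx /(_ i ji) zy].
by apply: xy; rewrite -zx -zy.
Qed.

(* Some edge in direction [d] is open between the cubes on the coordinates
   below [j] based at [x] and at [x + e d]. *)
Fixpoint link (j : nat) x (d : nat) (w : spanning Zn) : Prop :=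
  if j is j'.+1 then link j' x d w \/ link j' (x + e j') d w
  else open_adj w (x : Zn) (x + e d).

Lemma ev_link j x d : (j <= d)%N ->
  ev (cyl j x `|` cyl j (x + e d)) [set w | link j x d w].
Proof.
elim: j x => [|j IHj] x jd.
  by apply: ev_adj; [left|right].
apply: evU.
  apply: (ev_sub _ (IHj x (ltnW jd))).
  by apply: setUSS; exact: cyl_le.
apply: (ev_sub _ (IHj (x + e j) (ltnW jd))); rewrite addrAC.
by apply: setUSS; apply: (subset_trans (cyl_le (leqnSn j))); exact: cyl_shift.
Qed.

(** * Probabilities of links and of good cubes *)

Section Model.
Variables (mu : model R Zn) (p : R).
Hypothesis mu_D : D_ge p mu.

Lemma Pr_edge x c : (c < n)%N -> Pr mu [set w | ~ open_adj w (x : Zn) (x + e c)] <= 1 - p.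
Proof.
move=> cn; have exy : edge_set Zn [set (x : Zn); x + e c].
  by exists x, (x + e c); split=> //; exact: adj_shift.
pose f : edge Zn := exist _ [set (x : Zn); x + e c] (mem_set exy).
have Tf : ev setT (open_event f) by exact: ev_open.
have fp : p <= Pr mu (open_event f).
  by rewrite -lee_fin -(PrE mu Tf); exact: (mu_D.2 f).
apply: (@le_trans _ _ (Pr mu (~` open_event f))); last by rewrite (PrC mu Tf) lerD2l lerN2.
have TA : ev setT [set w | open_adj w (x : Zn) (x + e c)] by exact: ev_adj.
by apply: (Pr_le mu (evC TA) (evC Tf)) => w h fw; apply: h; exists f.
Qed.

(** The two halves of a link lie in cylinders that differ at coordinate [j], which the shift along
    [d] leaves alone; their failures are independent and the exponent doubles. *)
Lemma Pr_link j x d : (j <= d)%N -> (d < n)%N ->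
  Pr mu [set w | ~ link j x d w] <= (1 - p) ^+ (2 ^ j).
Proof.
move=> + dn; elim: j x => [|j IHj] x jd; first by rewrite expr1; exact: Pr_edge.
have jn : (j < n)%N by exact: ltn_trans jd dn.
have h1 := @ev_link j x d (ltnW jd); have h2 := @ev_link j (x + e j) d (ltnW jd).
have -> : [set w | ~ link j.+1 x d w] =
    (~` [set w | link j x d w]) `&` (~` [set w | link j (x + e j) d w]).
  by rewrite -setCU.
rewrite (Pr_indep mu_D.1 _ (evC h1) (evC h2)); last first.
  have xj (z z' : 'rV[int]_n) : z ord0 (Ordinal jn) = x ord0 (Ordinal jn) ->
      z' ord0 (Ordinal jn) = x ord0 (Ordinal jn) + 1 -> cyl j z `&` cyl j z' = set0.
    by move=> zx z'x; apply: (@cyl_disj _ _ _ (Ordinal jn)) => //; rewrite zx z'x; lia.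
  have jd' : (j == d) = false by apply/negbTE; rewrite neq_ltn jd.
  rewrite setIUr !setIUl !xj ?setU0 // !shiftE /= ?eqxx ?jd' ?addr0 //.
by rewrite expnS mul2n -addnn exprD; apply: ler_pM; rewrite ?Pr_ge0 //; apply: IHj; exact: ltnW.
Qed.

Section Good.
Variables (k : nat) (P : R).
Hypothesis hconn : forall mu : model R (hypercube k), D_ge p mu ->
  (P%:E <= mu [set w | graph_connected (subgraph w)])%E.

(** [insub] gives [None] from coordinate [k] on, where the image keeps the value of [x]. *)
Definition cube_map x (b : hypercube k) : Zn :=
  \row_j (x ord0 j + (if insub (j : nat) is Some i then ((b : {ffun _}) i)%:R else 0)).

Lemma cube_mapE x b (i : 'I_k) (j : 'I_n) : (i = j :> nat) ->
  (cube_map x b : 'rV[int]_n) ord0 j = x ord0 j + ((b : {ffun _}) i)%:R.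
Proof.
move=> ij; rewrite mxE; case: insubP => [i' _ i'j|]; last by rewrite -ij ltn_ord.
by rewrite (_ : i' = i) //; apply: val_inj; rewrite /= i'j.
Qed.

Hypothesis kn : (k <= n)%N.

Lemma cube_map_inj x : injective (cube_map x).
Proof.
move=> b b' /rowP h; apply/ffunP => i; have := h (widen_ord kn i).
by rewrite !(@cube_mapE _ _ i) // => /addrI; case: (b i) (b' i) => [] [].
Qed.

Lemma cube_map_adj x b b' : adj (hypercube k) b b' -> adj Zn (cube_map x b) (cube_map x b').
Proof.
move=> /eqP /cards1P[i hi].
have bi j : (b j != b' j) = (j == i).
  by have /setP/(_ j) := hi; rewrite !finset.inE.
apply: (@dist1P _ _ (widen_ord kn i)) => [|j ji].
  rewrite !(@cube_mapE _ _ i) // opprD addrACA subrr add0r.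
  by have := bi i; rewrite eqxx; case: (b i) (b' i) => [] [].
rewrite !mxE; case: insubP => // i' _ i'j; congr (_ + _%:R).
have i'i : (i' == i) = false.
  by apply/eqP => i'i; move/eqP: ji; apply; apply: val_inj; rewrite /= -i'i.
by have := bi i'; rewrite i'i => /negbT; rewrite negbK => /eqP ->.
Qed.

Definition conn (w : spanning Zn) x y : Prop := component (G := subgraph w) (x : Zn) (y : Zn).

(* A sufficient condition for the cube on the coordinates below [k + i] based
   at [x] to be connected. *)
Fixpoint good (i : nat) x (w : spanning Zn) : Prop :=
  if i is i'.+1 then good i' x w /\ good i' (x + e (k + i')) w /\ link (k + i') x (k + i') w
  else graph_connected (subgraph (pull (@cube_map_adj x) w)).

Lemma ev_good i x : ev (cyl (k + i) x) [set w | good i x w].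
Proof.
elim: i x => [|i IHi] x.
  have TC : ev setT [set w : spanning (hypercube k) | graph_connected (subgraph w)].
    exact: (@ev_graph_connected (hypercube k) {ffun 'I_k -> bool} id id (fun=> erefl)).
  apply: (ev_sub _ (ev_pull (@cube_map_adj x) TC)) => _ [b _ <-] j kj.
  rewrite addn0 in kj; rewrite mxE insubF ?addr0 //; apply/negbTE.
  by rewrite -leqNgt.
have sub : cyl (k + i) (x + e (k + i)) `<=` cyl (k + i.+1) x.
  apply: (subset_trans (@cyl_le _ (k + i.+1) _ _)); first by rewrite addnS.
  by apply: cyl_shift; rewrite addnS.
have sub' : cyl (k + i) x `<=` cyl (k + i.+1) x by apply: cyl_le; rewrite addnS.
apply: evI; first exact: (ev_sub sub' (IHi x)).
apply: evI; first exact: (ev_sub sub (IHi _)).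
apply: (ev_sub _ (@ev_link (k + i) x (k + i) (leqnn _))).
by move=> y [/sub'|/sub].
Qed.

(** The recursion for [P_j] with [j = k + i], taken with equality and started at [P]. *)
Fixpoint good_bound (i : nat) : R :=
  if i is i'.+1 then good_bound i' ^+ 2 - (1 - p) ^+ (2 ^ (k + i')) else P.

(** The two halves are independent, being separated at coordinate [k + i], and requiring the link
    costs at most its failure probability. Nonnegative earlier bounds can be multiplied. *)
Lemma Pr_good i x : (k + i <= n)%N -> (forall j, (j < i)%N -> 0 <= good_bound j) ->
  good_bound i <= Pr mu [set w | good i x w].
Proof.
elim: i x => [|i IHi] x kin pos.
  have TC : ev setT [set w : spanning (hypercube k) | graph_connected (subgraph w)].
    exact: (@ev_graph_connected (hypercube k) {ffun 'I_k -> bool} id id (fun=> erefl)).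
  have TG := @ev_good 0 x; rewrite -lee_fin -(PrE mu TG).
  apply: (hconn (mu := pull_model (@cube_map_adj x) mu)).
  by apply: pull_D_ge => //; exact: cube_map_inj.
rewrite addnS in kin.
have h1 := @ev_good i x; have h2 := @ev_good i (x + e (k + i)).
have h3 := @ev_link (k + i) x (k + i) (leqnn _).
have h12 := evI (ev_sub (@subsetT _ _) h1) (ev_sub (@subsetT _ _) h2).
have p12 : Pr mu ([set w | good i x w] `&` [set w | good i (x + e (k + i)) w]) =
    Pr mu [set w | good i x w] * Pr mu [set w | good i (x + e (k + i)) w].
  apply: (Pr_indep mu_D.1 _ h1 h2); apply: (@cyl_disj _ _ _ (Ordinal kin)) => //.
  by rewrite shiftE /= eqxx; lia.
have bi j : (j < i)%N -> 0 <= good_bound j by move=> ji; apply: pos; exact: ltnW.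
have g1 := IHi x (ltnW kin) bi; have g2 := IHi (x + e (k + i)) (ltnW kin) bi.
have g3 := @Pr_link (k + i) x (k + i) (leqnn _) kin.
have := Pr_split mu h12 h3; rewrite -setIA p12 => s12.
have le3 : Pr mu ([set w | good i x w] `&` [set w | good i (x + e (k + i)) w] `&`
    ~` [set w | link (k + i) x (k + i) w]) <= Pr mu [set w | ~ link (k + i) x (k + i) w].
  have T3 := ev_sub (@subsetT _ _) (evC h3).
  by apply: (Pr_le mu (evI h12 T3) T3) => w [].
have -> : [set w | good i.+1 x w] = [set w | good i x w] `&`
  ([set w | good i (x + e (k + i)) w] `&` [set w | link (k + i) x (k + i) w]) by [].
have gg : good_bound i ^+ 2 <=
    Pr mu [set w | good i x w] * Pr mu [set w | good i (x + e (k + i)) w].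
  by rewrite expr2; apply: ler_pM => //; exact: pos.
move: s12 le3 gg g3; rewrite /=; lra.
Qed.

Definition box (j : nat) x (y : 'rV[int]_n) : Prop := forall i : 'I_n,
  if (i < j)%N then y ord0 i = x ord0 i \/ y ord0 i = x ord0 i + 1
  else y ord0 i = x ord0 i.

Lemma box_refl j x : box j x x.
Proof. by move=> i; case: ifP => _ //; left. Qed.

Lemma boxS j x y : box j.+1 x y -> box j x y \/ box j (x + e j) y.
Proof.
move=> h; case: (ltnP j n) => [jn|nj]; last first.
  by left=> i; have := h i; rewrite !(leq_trans (ltn_ord i)) // ltnW.
have := h (Ordinal jn); rewrite /= ltnSn => -[yj|yj].
  left=> i; case: ifP => ij; first by have := h i; rewrite ltnS ltnW.
  case: (ltngtP i j) ij => // [ji _|ij _]; first by have := h i; rewrite ltnS leqNgt ji.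
  by rewrite (_ : i = Ordinal jn) //; exact: val_inj.
right=> i; rewrite shiftE.
case: (ltngtP i j) => [ij|ji|ij]; first by have := h i; rewrite ltnS ltnW // addr0.
  by have := h i; rewrite ltnS leqNgt ji addr0.
by rewrite (_ : i = Ordinal jn) //; exact: val_inj.
Qed.

Lemma box_shift j x y : box j (x + e j) y -> box j.+1 x y.
Proof.
move=> h i; have := h i; rewrite shiftE ltnS.
by case: (ltngtP i j) => ij; rewrite ?addr0 //; right.
Qed.

Lemma box_le j x y : box j x y -> box j.+1 x y.
Proof.
move=> h i; have := h i; rewrite ltnS.
by case: (ltngtP i j) => ij // ->; left.
Qed.

Lemma link_box j x d w : link j x d w ->
  exists y z, [/\ box j x y, box j (x + e d) z & conn w y z].
Proof.
elim: j x => [|j IHj] x /=.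
  by move=> xy; exists x, (x + e d); split; [exact: box_refl|exact: box_refl|exact: rt_step].
case=> /IHj[y [z [xy dz yz]]]; exists y, z; split=> //; try exact: box_le.
  exact: box_shift.
by apply: box_shift; rewrite addrAC.
Qed.

Lemma good_box i x w y : good i x w -> box (k + i) x y -> conn w x y.
Proof.
elim: i x y => [|i IHi] x y /=.
  rewrite addn0 => g h.
  pose b : hypercube k :=
    [ffun i : 'I_k => y ord0 (widen_ord kn i) != x ord0 (widen_ord kn i)].
  pose b0 : hypercube k := [ffun => false].
  have -> : y = cube_map x b.
    apply/rowP => j; have := h j; case: ifP => jk.
      rewrite (@cube_mapE _ _ (Ordinal jk)) // ffunE.
      rewrite (_ : widen_ord kn _ = j); last exact: val_inj.
      by case: eqP => [->|_ [] // ->]; rewrite ?addr0.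
    by rewrite mxE insubF // addr0.
  have xE : cube_map x b0 = x.
    apply/rowP => j; rewrite mxE; case: insubP => [i' _ _|]; rewrite ?ffunE addr0 //.
  by have := pull_component (g b0 b); rewrite xE.
rewrite addnS => -[g1 [g2 l]] /boxS[]; first exact: IHi.
(* Here [y] is in the upper half: the path crosses from [u] to [v], then passes through the base of
   that half. *)
move=> /(IHi _ _ g2) h2; have [u [v [xu xv uv]]] := link_box l.
have xz := component_trans (IHi _ _ g1 xu) uv.
exact: (component_trans (component_trans xz (component_sym (IHi _ _ g2 xv))) h2).
Qed.

Lemma good_link_conn i x d w : good i x w -> good i (x + e d) w ->
  link (k + i) x d w -> conn w x (x + e d).
Proof.
move=> g1 g2 /link_box[u [v [xu xv uv]]].
have xz := component_trans (good_box g1 xu) uv.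
exact: (component_trans xz (component_sym (good_box g2 xv))).
Qed.

End Good.
End Model.
End Blocks.

(** * First success *)

Section FirstSuccess.
Variables (R : realType) (G : graph) (mu : model R G).
Implicit Types (T : set (spanning G)) (A B : nat -> spanning G -> Prop).

Definition none_before A (i : nat) : set (spanning G) :=
  [set w | forall i', (i' < i)%N -> ~ A i' w].

Definition first_at A (i : nat) : set (spanning G) :=
  none_before A i `&` [set w | A i w].

(* This includes the case where no [A i] with [i < N] occurs. *)
Definition first_bad A B (N : nat) : set (spanning G) :=
  [set w | forall i, (i < N)%N -> first_at A i w -> B i w].

Lemma ev_none_before U A i : (forall i', (i' < i)%N -> ev U [set w | A i' w]) ->
  ev U (none_before A i).
Proof.
move=> UA; apply: ev_forall => i'; apply: ev_imply => i'i.
exact: (evC (UA _ i'i)).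
Qed.

Lemma ev_first_at U A i : (forall i', (i' <= i)%N -> ev U [set w | A i' w]) ->
  ev U (first_at A i).
Proof.
move=> UA; apply: (evI (@ev_none_before U A i _) (UA i _)) => // i' i'i.
by apply: UA; exact: ltnW.
Qed.

Lemma ev_first_bad U A B N : (forall i, (i < N)%N -> ev U [set w | A i w]) ->
  (forall i, (i < N)%N -> ev U [set w | B i w]) -> ev U (first_bad A B N).
Proof.
move=> UA UB; apply: ev_forall => i; apply: ev_imply => iN.
have -> : [set w | first_at A i w -> B i w] = ~` first_at A i `|` [set w | B i w].
  apply/seteqP; split=> w /=; last by case.
  by case: (pselect (first_at A i w)) => [f /(_ f)|]; [right|left].
apply: (evU (evC (@ev_first_at U A i _)) (UB i iN)) => i' i'i.
by apply: UA; exact: leq_ltn_trans iN.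
Qed.

(** Split by the index of the first success: at each index [B] costs a factor [b], and the search
    finds nothing with probability at most [(1 - r) ^+ N]. All this is relative to [T], which
    records earlier explorations. *)
Lemma Pr_first_bad T A B N (b r : R) : 0 <= b -> r <= 1 -> ev setT T ->
  (forall i, (i < N)%N -> ev setT [set w | A i w]) ->
  (forall i, (i < N)%N -> ev setT [set w | B i w]) ->
  (forall i, (i < N)%N ->
     Pr mu (T `&` first_at A i `&` [set w | B i w]) <= b * Pr mu (T `&` first_at A i)) ->
  (forall i, (i < N)%N -> Pr mu (T `&` none_before A i `&` ~` [set w | A i w])
     <= (1 - r) * Pr mu (T `&` none_before A i)) ->
  Pr mu (T `&` first_bad A B N) <= (b + (1 - r) ^+ N) * Pr mu T.
Proof.
move=> b0 r1 TT TA TB hb hr.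
(* Bad first successes among the first [i] trials; their probability is compared with the mass that
   [none_before] has lost so far. *)
pose D i := T `&` [set w | exists2 i', (i' < i)%N & first_at A i' w /\ B i' w].
have Tn i : (i <= N)%N -> ev setT (T `&` none_before A i).
  move=> iN; apply: evI => //; apply: ev_none_before => i' i'i; apply: TA.
  exact: leq_trans iN.
have Tf i : (i < N)%N -> ev setT (T `&` first_at A i).
  move=> iN; apply: evI => //; apply: ev_first_at => i' i'i; apply: TA.
  exact: leq_ltn_trans iN.
have TD i : (i <= N)%N -> ev setT (D i).
  move=> iN; apply: evI => //.
  have -> : [set w | exists2 i', (i' < i)%N & first_at A i' w /\ B i' w] =
      ~` first_bad A (fun i w => ~ B i w) i.
    apply/seteqP; split=> w /=; first by move=> [i' i'i [f Bi']] /(_ i' i'i f).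
    by move=> /existsNP[i' /not_implyP[i'i /not_implyP[f /contrapT Bi']]]; exists i'.
  apply: evC; apply: ev_first_bad => i' i'i; first by apply: TA; exact: leq_trans iN.
  by apply: evC; apply: TB; exact: leq_trans iN.
have split_none i : (i < N)%N -> Pr mu (T `&` none_before A i) =
    Pr mu (T `&` first_at A i) + Pr mu (T `&` none_before A i.+1).
  move=> iN; rewrite (Pr_split mu (Tn i (ltnW iN)) (TA i iN)) -setIA; congr (_ + Pr mu _).
  apply/seteqP; split=> w.
    move=> [[Tw nw] Aw]; split=> // i'; rewrite ltnS leq_eqVlt => /orP[/eqP -> //|].
    exact: nw.
  move=> [Tw nw]; split; last exact: nw.
  by split=> // i' i'i; apply: nw; exact: ltnW.
have none_le i : (i <= N)%N -> Pr mu (T `&` none_before A i) <= (1 - r) ^+ i * Pr mu T.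
  elim: i => [|i IHi] iN.
    rewrite expr0 mul1r; apply: (Pr_le mu (Tn 0%N iN) TT); exact: subIsetl.
  have -> : T `&` none_before A i.+1 = T `&` none_before A i `&` ~` [set w | A i w].
    apply/seteqP; split=> w.
      by move=> [Tw nw]; split; [split=> // i' i'i; apply: nw; exact: ltnW|exact: nw].
    move=> [[Tw nw] Aw]; split=> // i'; rewrite ltnS leq_eqVlt => /orP[/eqP -> //|].
    exact: nw.
  apply: (le_trans (hr i iN)); rewrite exprS -mulrA ler_wpM2l ?subr_ge0 //.
  exact: IHi (ltnW iN).
have D_le i : (i <= N)%N -> Pr mu (D i) <= b * (Pr mu T - Pr mu (T `&` none_before A i)).
  elim: i => [|i IHi] iN.
    have -> : D 0%N = set0 by apply/seteqP; split=> // w [_ []].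
    rewrite /Pr measure0 mulr_ge0 // subr_ge0.
    by apply: (Pr_le mu (Tn 0%N iN) TT); exact: subIsetl.
  have TfB := evI (Tf i iN) (TB i iN).
  apply: (@le_trans _ _ (Pr mu (D i) + Pr mu (T `&` first_at A i `&` [set w | B i w]))).
    apply: le_trans (PrU_le mu (TD i (ltnW iN)) TfB).
    apply: (Pr_le mu (TD i.+1 iN) (evU (TD i (ltnW iN)) TfB)) => w.
    move=> [Tw [i']]; rewrite ltnS leq_eqVlt => /orP[/eqP -> [f Bi]|i'i fB]; first by right.
    by left; split=> //; exists i'.
  have := IHi (ltnW iN); have := hb i iN; rewrite (split_none i iN); lra.
have TFB : ev setT (T `&` first_bad A B N) by apply: evI => //; exact: ev_first_bad.
apply: (@le_trans _ _ (Pr mu (D N) + Pr mu (T `&` none_before A N))).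
  apply: le_trans (PrU_le mu (TD N (leqnn _)) (Tn N (leqnn _))).
  apply: (Pr_le mu TFB (evU (TD N (leqnn _)) (Tn N (leqnn _)))) => w [Tw fw].
  case: (pselect (none_before A N w)) => [nw|nw]; first by right.
  left; split=> //.
  have [i iN Ai] : exists2 i, (i < N)%N & A i w.
    by move: nw => /existsNP[i /not_implyP[iN /contrapT Ai]]; exists i.
  have exi : exists i, (i < N)%N && `[< A i w >] by exists i; rewrite iN; apply/asboolP.
  case: (ex_minnP exi) => i0 /andP[i0N /asboolP Ai0] min0; exists i0 => //.
  have f0 : first_at A i0 w.
    split=> // i' i'i0 Ai'; have := min0 i'.
    by rewrite (ltn_trans i'i0 i0N) => /(_ (introT (asboolP _) Ai')); rewrite leqNgt i'i0.
  by split=> //; exact: fw.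
have := D_le N (leqnn _); have := none_le N (leqnn _).
have := Pr_ge0 mu (T `&` none_before A N); nra.
Qed.

End FirstSuccess.

(** * Cells, hubs and connectors *)

Section Cells.
Variables (R : realType) (n K L m : nat).
Hypothesis hn : (K.+2 + L + m <= n)%N.
Notation Zn := (lattice R n).
Implicit Types (x y : 'rV[int]_n).
Local Notation e := (unit_row n).

(* A site is coded by its cell, a hub direction and a connector direction. *)
Notation code := (cell * option nat * option nat)%type.

(** Coordinates below [K] are internal to the cube; then come the two coordinates of the cell, [L]
    hub directions and [m] connector directions. [None] stands for zeros in all hub, respectively
    connector, directions. *)
Definition site_coord (c : code) (i : nat) : nat :=
  if (i < K)%N then 0
  else if i == K then c.1.1.1
  else if i == K.+1 then c.1.1.2
  else if (i < K.+2 + L)%N then c.1.2 == Some (i - K.+2)%N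
  else c.2 == Some (i - (K.+2 + L))%N.

Definition site (c : code) : 'rV[int]_n := \row_i (site_coord c i)%:R.

Definition valid (c : code) : Prop :=
  (if c.1.2 is Some a then (a < L)%N else true) &&
  (if c.2 is Some j then (j < m)%N else true).

Definition hub (a : nat) := (K.+2 + a)%N.
Definition connector (j : nat) := (K.+2 + L + j)%N.
Definition dir (d : bool) := if d then K else K.+1.

Lemma site_hub s a J : (a < L)%N -> site (s, Some a, J) = site (s, None, J) + e (hub a).
Proof.
move=> aL; apply/rowP => i; rewrite shiftE !mxE /site_coord /hub /=.
case: ifP => iK; first by rewrite (_ : (i == _ :> nat) = false) ?addr0 //; lia.
case: eqP => iK0; first by rewrite (_ : (i == _ :> nat) = false) ?addr0 //; lia.
case: eqP => iK1; first by rewrite (_ : (i == _ :> nat) = false) ?addr0 //; lia.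
case: ifP => iL; last by rewrite (_ : (i == _ :> nat) = false) ?addr0 //; lia.
by rewrite add0r; congr (nat_of_bool _)%:R; apply/eqP/eqP => [[->]|->]; [lia|congr Some; lia].
Qed.

Lemma site_connector s A j : (j < m)%N ->
  site (s, A, Some j) = site (s, A, None) + e (connector j).
Proof.
move=> jm; apply/rowP => i; rewrite shiftE !mxE /site_coord /connector /=.
case: ifP => iK; first by rewrite (_ : (i == _ :> nat) = false) ?addr0 //; lia.
case: eqP => iK0; first by rewrite (_ : (i == _ :> nat) = false) ?addr0 //; lia.
case: eqP => iK1; first by rewrite (_ : (i == _ :> nat) = false) ?addr0 //; lia.
case: ifP => iL; first by rewrite (_ : (i == _ :> nat) = false) ?addr0 //; lia.
by rewrite add0r; congr (nat_of_bool _)%:R; apply/eqP/eqP => [[->]|->]; [lia|congr Some; lia].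
Qed.

Lemma site_step s d A J : site (step d s, A, J) = site (s, A, J) + e (dir d).
Proof.
apply/rowP => i; rewrite shiftE !mxE /site_coord /dir /=.
case: ifP => iK; first by rewrite (_ : (i == _ :> nat) = false) ?addr0 //; case: d; lia.
case: eqP => iK0; first by rewrite iK0; case: d => /=; rewrite ?eqxx -natrD; congr _%:R; lia.
case: eqP => iK1; first by rewrite iK1; case: d => /=; rewrite ?eqxx -natrD; congr _%:R; lia.
by rewrite (_ : (i == _ :> nat) = false) ?addr0 //; case: d; lia.
Qed.

(** The coordinates from [K] on determine a valid code, whereas a hub index out of range would have
    the same coordinates as [None]. *)
Lemma site_inj c c' y : valid c -> valid c' ->
  @cyl R n K (site c) y -> @cyl R n K (site c') y -> c = c'.
Proof.
case: c c' => [[[s1 s2] A] J] [[[s1' s2'] A'] J'] /andP[/= vA vJ] /andP[/= vA' vJ'] cy cy'.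
have E (i : nat) : (K <= i)%N -> (i < n)%N ->
    site_coord (s1, s2, A, J) i = site_coord (s1', s2', A', J') i.
  move=> Ki ni; have := cy (Ordinal ni) Ki; rewrite (cy' (Ordinal ni) Ki) !mxE /=.
  by move=> /eqP; rewrite eqr_nat => /eqP.
have E0 : s1 = s1'.
  by have := E K (leqnn _); rewrite /site_coord ltnn eqxx /=; apply; lia.
have E1 : s2 = s2'.
  have := E K.+1 (leqnSn _); rewrite /site_coord (_ : (_ < K)%N = false); last lia.
  rewrite (_ : (_ == K) = false) ?eqxx /=; last lia.
  by apply; lia.
have EA a : (a < L)%N -> (A == Some a) = (A' == Some a).
  move=> aL; have := E (hub a); rewrite /site_coord /hub.
  rewrite (_ : (_ < K)%N = false); last lia.
  rewrite (_ : (_ == K) = false); last lia.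
  rewrite (_ : (_ == K.+1) = false); last lia.
  rewrite (_ : (K.+2 + a < K.+2 + L)%N); last lia.
  rewrite (_ : (K.+2 + a - K.+2)%N = a) /=; last lia.
  by case: (A == _) (A' == _) => [] [] // h; have := h ltac:(lia) ltac:(lia).
have EJ j : (j < m)%N -> (J == Some j) = (J' == Some j).
  move=> jm; have := E (connector j); rewrite /site_coord /connector.
  rewrite (_ : (_ < K)%N = false); last lia.
  rewrite (_ : (_ == K) = false); last lia.
  rewrite (_ : (_ == K.+1) = false); last lia.
  rewrite (_ : (_ < K.+2 + L)%N = false); last lia.
  rewrite (_ : (K.+2 + L + j - (K.+2 + L))%N = j) /=; last lia.
  by case: (J == _) (J' == _) => [] [] // h; have := h ltac:(lia) ltac:(lia).
rewrite E0 E1; congr (_, _, _).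
- case: A A' vA vA' EA {E cy cy'} => [a|] [a'|] vA vA' EA //.
  + by have := EA _ vA; rewrite eqxx => /esym/eqP.
  + by have := EA _ vA; rewrite eqxx.
  + by have := EA _ vA'; rewrite eqxx.
- case: J J' vJ vJ' EJ {E cy cy'} => [j|] [j'|] vJ vJ' EJ //.
  + by have := EJ _ vJ; rewrite eqxx => /esym/eqP.
  + by have := EJ _ vJ; rewrite eqxx.
  + by have := EJ _ vJ'; rewrite eqxx.
Qed.

Definition zone (Q : set code) : set Zn :=
  [set y | exists c, [/\ Q c, valid c & @cyl R n K (site c) y]].

Lemma zone_disj Q Q' : Q `&` Q' = set0 -> zone Q `&` zone Q' = set0.
Proof.
move=> QQ'; apply/seteqP; split=> // y [[c [Qc vc cy]] [c' [Qc' vc' cy']]].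
have cc' := site_inj vc vc' cy cy'.
by have : (Q `&` Q') c by [split=> //; rewrite cc']; rewrite QQ'.
Qed.

Variables (mu : model R Zn) (g : 'rV[int]_n -> spanning Zn -> Prop)
  (lk : 'rV[int]_n -> nat -> spanning Zn -> Prop) (P eta : R).
Hypotheses (mu_indep : one_independent mu)
  (ev_g : forall x, ev (@cyl R n K x) [set w | g x w])
  (ev_lk : forall x d, (K <= d)%N -> ev (@cyl R n K x `|` @cyl R n K (x + e d)) [set w | lk x d w])
  (P_gt0 : 0 < P) (eta_ge0 : 0 <= eta)
  (Pr_g : forall x, P <= Pr mu [set w | g x w])
  (Pr_lk : forall x d, (K <= d)%N -> (d < n)%N ->
     Pr mu [set w | ~ lk x d w] <= eta * P ^+ 2)
  (g_lk_conn : forall x d w, g x w -> g (x + e d) w -> lk x d w -> conn w x (x + e d)).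

Definition gs (c : code) (w : spanning Zn) : Prop := g (site c) w.

Lemma ev_gs Q c : Q c -> valid c -> ev (zone Q) [set w | gs c w].
Proof. by move=> Qc vc; apply: (ev_sub _ (@ev_g (site c))) => y cy; exists c. Qed.

Lemma P_le1 : P <= 1.
Proof. exact: le_trans (Pr_g 0) (Pr_le1 mu (@ev_g 0)). Qed.

Lemma Pr_link_fail (W T : set (spanning Zn)) Q c c' d :
  valid c -> valid c' -> (K <= d)%N -> (d < n)%N -> site c' = site c + e d -> c <> c' ->
  Q `&` [set c'' | c'' = c \/ c'' = c'] = set0 -> ev (zone Q) T ->
  W = T `&` ([set w | gs c w] `&` [set w | gs c' w]) ->
  Pr mu (W `&` [set w | ~ lk (site c) d w]) <= eta * Pr mu W.
Proof.
move=> vc vc' Kd dn c'E cc' QQ QT ->.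
(* [T] is independent of the link, and intersecting it with the two good events
   multiplies its probability by at least [P ^+ 2]. *)
pose Q2 : set code := [set c'' | c'' = c \/ c'' = c'].
have h1 : ev (zone [set c]) [set w | gs c w] by exact: ev_gs.
have h2 : ev (zone [set c']) [set w | gs c' w] by exact: ev_gs.
have h12 : ev (zone Q2) ([set w | gs c w] `&` [set w | gs c' w]).
  by apply: evI; apply: ev_gs => //; [left|right].
have hl : ev (zone Q2) [set w | ~ lk (site c) d w].
  apply: evC; apply: (ev_sub _ (@ev_lk (site c) d Kd)) => y [] cy.
    by exists c; split=> //; left.
  by exists c'; split=> //; [right|rewrite c'E].
have ZQ := zone_disj QQ.
rewrite (Pr_indep mu_indep ZQ QT h12) (Pr_indep mu_indep _ h1 h2); last first.
  by apply: zone_disj; apply/seteqP; split=> // c'' [-> ?]; exact: cc'.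
apply: (@le_trans _ _ (Pr mu (T `&` [set w | ~ lk (site c) d w]))).
  have [TT [T12 Tl]] : ev setT T /\ ev setT ([set w | gs c w] `&` [set w | gs c' w]) /\
      ev setT [set w | ~ lk (site c) d w].
    by split; [exact: (ev_sub _ QT)|split; [exact: (ev_sub _ h12)|exact: (ev_sub _ hl)]].
  by apply: (Pr_le mu (evI (evI TT T12) Tl) (evI TT Tl)) => w [[]].
rewrite (Pr_indep mu_indep ZQ QT hl) mulrCA ler_wpM2l ?Pr_ge0 //.
apply: (le_trans (Pr_lk _ Kd dn)); rewrite ler_wpM2l // expr2.
by apply: ler_pM => //; rewrite ?(ltW P_gt0) //; exact: Pr_g.
Qed.

Lemma Pr_zone_not T A Q Q' (r : R) : Q `&` Q' = set0 -> ev (zone Q) T -> ev (zone Q') A ->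
  r <= Pr mu A -> Pr mu (T `&` ~` A) <= (1 - r) * Pr mu T.
Proof.
move=> QQ QT QA rA; rewrite (Pr_indep mu_indep (zone_disj QQ) QT (evC QA)) (PrC mu QA).
by rewrite mulrC ler_wpM2r ?Pr_ge0 // lerD2l lerN2.
Qed.

Lemma Pr_all_gs (cs : seq code) : uniq cs -> (forall c, c \in cs -> valid c) ->
  P ^+ size cs <= Pr mu [set w | forall c, c \in cs -> gs c w].
Proof.
elim: cs => [|c cs IHcs] /=.
  have -> : [set w | forall c, c \in [::] -> gs c w] = setT by apply/seteqP; split.
  by rewrite PrT.
move=> /andP[ccs ucs] vcs; have vc := vcs c (mem_head _ _).
have vcs' c' : c' \in cs -> valid c' by move=> c'cs; apply: vcs; rewrite inE c'cs orbT.
have h1 : ev (zone [set c]) [set w | gs c w] by exact: ev_gs.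
have h2 : ev (zone [set` cs]) [set w | forall c', c' \in cs -> gs c' w].
  by apply: ev_forall => c'; apply: ev_imply => c'cs; apply: ev_gs => //; exact: vcs'.
have -> : [set w | forall c', c' \in c :: cs -> gs c' w] =
    [set w | gs c w] `&` [set w | forall c', c' \in cs -> gs c' w].
  apply/seteqP; split=> w.
    by move=> h; split=> [|c' c'cs]; apply: h; rewrite inE ?eqxx ?c'cs ?orbT.
  by move=> [h1w h2w] c'; rewrite inE => /orP[/eqP -> //|]; exact: h2w.
rewrite (Pr_indep mu_indep _ h1 h2).
  rewrite exprS; apply: ler_pM; rewrite ?exprn_ge0 ?(ltW P_gt0) //; first exact: Pr_g.
  exact: IHcs.
by apply: zone_disj; apply/seteqP; split=> // c' [-> /=]; apply/negP.
Qed.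

(** * Joining the first good hubs of adjacent cells *)

Definition hub_code (s : cell) (a : nat) : code := (s, Some a, None).

Definition path_codes (s : cell) (d : bool) (a b j : nat) : seq code :=
  [:: (s, Some a, Some j); (s, None, Some j); (step d s, None, Some j);
      (step d s, Some b, Some j)].

Definition path_good s d a b j w : Prop :=
  forall c, c \in path_codes s d a b j -> gs c w.

(** In each triple the second site is the first one shifted along the third component, so the second
    and fifth links are listed against the sense of travel. *)
Definition path_links (s : cell) (d : bool) (a b j : nat) : seq (code * code * nat) :=
  [:: (hub_code s a, (s, Some a, Some j), connector j);
      ((s, None, Some j), (s, Some a, Some j), hub a);
      ((s, None, Some j), (step d s, None, Some j), dir d);
      ((step d s, None, Some j), (step d s, Some b, Some j), hub b);
      (hub_code (step d s) b, (step d s, Some b, Some j), connector j)].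

Definition path_unlinked s d a b j w : Prop :=
  exists2 l, l \in path_links s d a b j & ~ lk (site l.1.1) l.2 w.

Definition hubs (s : cell) (a : nat) (w : spanning Zn) : Prop := gs (hub_code s a) w.

(** Three nested searches: a good hub of [s], a good hub of its neighbour, a good path. At each
    stage, finding nothing counts as failure. *)
Definition fail_path s d a b : set (spanning Zn) :=
  first_bad (path_good s d a b) (path_unlinked s d a b) m.
Definition fail_target s d a : set (spanning Zn) :=
  first_bad (hubs (step d s)) (fun b w => fail_path s d a b w) L.
Definition fail_edge s d : set (spanning Zn) :=
  first_bad (hubs s) (fun a w => fail_target s d a w) L.

Lemma step_neq d s : step d s <> s.
Proof. by case: s d => s1 s2 [] /(congr1 (fun t => t.1 + t.2)%N) /=; lia. Qed.

Section FailBounds.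
Variables (s : cell) (d : bool).

Lemma valid_path a b j c : (a < L)%N -> (b < L)%N -> (j < m)%N ->
  c \in path_codes s d a b j -> valid c.
Proof.
move=> aL bL jm; rewrite !inE => /or4P[] /eqP ->; by rewrite /valid /= ?aL ?bL ?jm.
Qed.

Lemma valid_hub s' a : (a < L)%N -> valid (hub_code s' a).
Proof. by move=> aL; rewrite /valid /= aL. Qed.

Lemma path_linksP a b j l : (a < L)%N -> (b < L)%N -> (j < m)%N ->
  l \in path_links s d a b j ->
  [/\ l.1.1 \in [:: hub_code s a, hub_code (step d s) b & path_codes s d a b j],
      l.1.2 \in [:: hub_code s a, hub_code (step d s) b & path_codes s d a b j],
      l.1.1 <> l.1.2, site l.1.2 = site l.1.1 + e l.2 & (K <= l.2 < n)%N].
Proof.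
move=> aL bL jm; rewrite inE => /or3P[/eqP ->|/eqP ->|].
- split=> //=; rewrite ?inE ?eqxx ?orbT //; first exact: site_connector.
  by rewrite /connector; lia.
- split=> //=; rewrite ?inE ?eqxx ?orbT //; first exact: site_hub.
  by rewrite /hub; lia.
rewrite inE => /or3P[/eqP ->|/eqP ->|].
- split=> //=; rewrite ?inE ?eqxx ?orbT //; [|exact: site_step|].
    by case=> /esym; exact: step_neq.
  by rewrite /dir; case: (d); lia.
- split=> //=; rewrite ?inE ?eqxx ?orbT //; first exact: site_hub.
  by rewrite /hub; lia.
rewrite orbF => /eqP ->; split=> //=; rewrite ?inE ?eqxx ?orbT //; first exact: site_connector.
by rewrite /connector; lia.
Qed.

Lemma ev_hubs Q s' a : Q (hub_code s' a) -> (a < L)%N -> ev (zone Q) [set w | hubs s' a w].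
Proof. by move=> Qc aL; apply: ev_gs => //; exact: valid_hub. Qed.

Lemma ev_path_good Q a b j : (a < L)%N -> (b < L)%N -> (j < m)%N ->
  (forall c, c \in path_codes s d a b j -> Q c) -> ev (zone Q) [set w | path_good s d a b j w].
Proof.
move=> aL bL jm Qp; apply: ev_forall => c; apply: ev_imply => cp.
by apply: ev_gs; [exact: Qp|exact: valid_path cp].
Qed.

Lemma valid_six a b j c : (a < L)%N -> (b < L)%N -> (j < m)%N ->
  c \in [:: hub_code s a, hub_code (step d s) b & path_codes s d a b j] -> valid c.
Proof.
move=> aL bL jm; rewrite inE => /orP[/eqP ->|]; first exact: valid_hub.
rewrite inE => /orP[/eqP ->|]; first exact: valid_hub.
exact: valid_path.
Qed.

Lemma ev_path_unlinked Q a b j : (a < L)%N -> (b < L)%N -> (j < m)%N ->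
  (forall c, c \in [:: hub_code s a, hub_code (step d s) b & path_codes s d a b j] -> Q c) ->
  ev (zone Q) [set w | path_unlinked s d a b j w].
Proof.
move=> aL bL jm Qp.
have -> : [set w | path_unlinked s d a b j w] =
    [set w | exists l, l \in path_links s d a b j /\ ~ lk (site l.1.1) l.2 w].
  by apply/seteqP; split=> w [l]; [exists l|case; exists l].
apply: ev_exists => l; apply: ev_and => /(path_linksP aL bL jm)[h1 h2 _ lE /andP[Kl _]].
apply: evC; apply: (ev_sub _ (@ev_lk (site l.1.1) l.2 Kl)) => y.
rewrite -lE => -[] cy.
  by exists l.1.1; split=> //; [exact: Qp|exact: valid_six h1].
by exists l.1.2; split=> //; [exact: Qp|exact: valid_six h2].
Qed.

(** Once the path is good, each of its five links is missing with conditional probability at most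
    [eta]; the power bounds the chance that none of the [m] disjoint paths is good. *)
Lemma Pr_fail_path a b : (a < L)%N -> (b < L)%N ->
  Pr mu (first_at (hubs s) a `&` first_at (hubs (step d s)) b `&` fail_path s d a b) <=
  (5 * eta + (1 - P ^+ 4) ^+ m) * Pr mu (first_at (hubs s) a `&` first_at (hubs (step d s)) b).
Proof.
move=> aL bL; set T := _ `&` first_at (hubs (step d s)) b.
(* Sites explored before path [j]: those with no connector direction or one below [j]. *)
pose QT (j : nat) : set code := [set c | c.2 = None \/ exists2 j', (j' < j)%N & c.2 = Some j'].
have evT j : ev (zone (QT j)) T.
  apply: evI; apply: ev_first_at => i ile; apply: ev_hubs; try by left.
    exact: leq_ltn_trans aL.
  exact: leq_ltn_trans bL.
have TT : ev setT T by exact: ev_sub (evT 0%N).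
have ev_none j : (j < m)%N -> ev (zone (QT j)) (none_before (path_good s d a b) j).
  move=> jm; apply: ev_none_before => j' j'j; apply: ev_path_good => //.
    exact: ltn_trans jm.
  by move=> c; rewrite !inE => /or4P[] /eqP -> /=; right; exists j'.
apply: Pr_first_bad => //.
- by rewrite mulr_ge0.
- by rewrite exprn_ile1 // ?(ltW P_gt0) // P_le1.
- by move=> j jm; apply: (ev_sub (@subsetT _ _) (@ev_path_good setT a b j _ _ _ _)).
- by move=> j jm; apply: (ev_sub (@subsetT _ _) (@ev_path_unlinked setT a b j _ _ _ _)).
- move=> j jm; set W := T `&` first_at _ j.
  (* [W] splits into [N], the failures of earlier trials, and the goodness of the six sites of the
     current one; [N] involves none of these six. *)
  pose six := [:: hub_code s a, hub_code (step d s) b & path_codes s d a b j].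
  pose N := none_before (hubs s) a `&` none_before (hubs (step d s)) b `&`
    none_before (path_good s d a b) j.
  have WE : W = N `&` [set w | forall c, c \in six -> gs c w].
    apply/seteqP; split=> w.
      move=> [[[na ga] [nb gb]] [nj gj]]; split=> // c.
      by rewrite inE => /orP[/eqP -> //|]; rewrite inE => /orP[/eqP -> //|]; exact: gj.
    move=> [[[na nb] nj] h]; split; [split; split=> //; apply: h|split=> // c cp; apply: h].
    + by rewrite inE eqxx.
    + by rewrite !inE eqxx orbT.
    + by rewrite inE [in X in _ || X]inE cp !orbT.
  pose QN : set code := [set c | (c.2 = None /\
     ((c.1.1 = s /\ exists2 a', (a' < a)%N & c.1.2 = Some a') \/
      (c.1.1 = step d s /\ exists2 b', (b' < b)%N & c.1.2 = Some b'))) \/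
     exists2 j', (j' < j)%N & c.2 = Some j'].
  have evN Q : QN `<=` Q -> ev (zone Q) N.
    move=> QNQ; apply: evI; first apply: evI.
    + apply: ev_none_before => a' a'a; apply: ev_hubs; last exact: ltn_trans aL.
      by apply: QNQ; left; split=> //; left; split=> //; exists a'.
    + apply: ev_none_before => b' b'b; apply: ev_hubs; last exact: ltn_trans bL.
      by apply: QNQ; left; split=> //; right; split=> //; exists b'.
    + apply: ev_none_before => j' j'j; apply: ev_path_good => //; first exact: ltn_trans jm.
      by move=> c; rewrite !inE => /or4P[] /eqP -> /=; apply: QNQ; right; exists j'.
  have nQN c : c \in six -> ~ QN c.
    have ltNn (i i' : nat) : (i' < i)%N -> Some i = Some i' -> False.
      by move=> + [ii']; rewrite ii' ltnn.
    rewrite inE => /orP[/eqP ->|]; last rewrite inE => /orP[/eqP ->|].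
    + case=> [[_ [[_ [a' a'a /= /(ltNn _ _ a'a)]] //|[/= ss' _]]]|[j' _ //]].
      by apply: (@step_neq d s).
    + case=> [[_ [[/= ss' _]|[_ [b' b'b /= /(ltNn _ _ b'b)]] //]]|[j' _ //]].
      by apply: (@step_neq d s).
    + by rewrite !inE => /or4P[] /eqP -> [[//]|[j' j'j /= /(ltNn _ _ j'j)]].
  have link_case l : l \in path_links s d a b j ->
      Pr mu (W `&` [set w | ~ lk (site l.1.1) l.2 w]) <= eta * Pr mu W.
    move=> lp; have [h1 h2 h12 lE /andP[Kl ln]] := path_linksP aL bL jm lp.
    (* The other four good sites join [N] in the factor independent of the link [l]. *)
    pose rest := [seq c <- six | (c != l.1.1) && (c != l.1.2)].
    pose Q : set code := QN `|` [set` rest].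
    apply: (@Pr_link_fail W (N `&` [set w | forall c, c \in rest -> gs c w]) Q l.1.1 l.1.2) => //.
    + exact: valid_six h1.
    + exact: valid_six h2.
    + apply/seteqP; split=> // c [[cQ|]].
        by case=> cE; apply: (nQN c) => //; rewrite cE.
      by rewrite /= mem_filter => /andP[/andP[/eqP c1 /eqP c2] _] [].
    + apply: evI; first by apply: evN => c ?; left.
      apply: ev_forall => c; apply: ev_imply => cr; apply: ev_gs; first by right.
      by apply: (@valid_six a b j) => //; move: cr; rewrite mem_filter => /andP[].
    + rewrite WE -setIA; congr (N `&` _); apply/seteqP; split=> w.
        move=> h; split; last by split; exact: h.
        by move=> c; rewrite mem_filter => /andP[_]; exact: h.
      move=> [hr [g1 g2]] c cs.
      have [->//|c1] := eqVneq c l.1.1; have [->//|c2] := eqVneq c l.1.2.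
      by apply: hr; rewrite mem_filter c1 c2.
  have TW : ev setT W.
    apply: evI => //; apply: ev_first_at => j' j'j.
    apply: (ev_sub (@subsetT _ _) (@ev_path_good setT a b j' _ _ _ _)) => //.
    exact: leq_ltn_trans jm.
  have -> : W `&` [set w | path_unlinked s d a b j w] =
      [set w | exists2 l, l \in path_links s d a b j & W w /\ ~ lk (site l.1.1) l.2 w].
    apply/seteqP; split=> w; first by move=> [Ww [l lp nl]]; exists l.
    by move=> [l lp [Ww nl]]; split=> //; exists l.
  rewrite -mulrA; apply: (@Pr_exists_le R Zn mu _ (path_links s d a b j)
     (fun l w => W w /\ ~ lk (site l.1.1) l.2 w)) => l lp; last exact: link_case.
  have [_ _ _ _ /andP[Kl ln]] := path_linksP aL bL jm lp.
  by apply: evI => //; apply: evC; apply: (ev_sub (@subsetT _ _) (@ev_lk (site l.1.1) l.2 Kl)).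
- move=> j jm.
  have path_uniq : uniq (path_codes s d a b j).
    have ss A J A' J' : (s, A, J) != (step d s, A', J') :> code.
      by apply/eqP => -[/esym /step_neq].
    by rewrite /= !inE !negb_or !ss !andbT; apply/andP; split; apply/eqP.
  have hP : P ^+ 4 <= Pr mu [set w | path_good s d a b j w].
    by apply: (@Pr_all_gs (path_codes s d a b j)) => // c; exact: valid_path.
  apply: (@Pr_zone_not _ _ (QT j) [set c | c.2 = Some j]) => //.
  + apply/seteqP; split=> // c [[c2|[j' j'j c2]]] /=; rewrite c2 => // -[jj'].
    by move: j'j; rewrite jj' ltnn.
  + by apply: evI => //; exact: ev_none.
  + by apply: ev_path_good => // c; rewrite !inE => /or4P[] /eqP ->.
Qed.

Lemma ev_fail_path Q a b : (a < L)%N -> (b < L)%N ->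
  (forall c, c.1.1 = s \/ c.1.1 = step d s -> Q c) -> ev (zone Q) (fail_path s d a b).
Proof.
move=> aL bL hQ; apply: ev_first_bad => j jm.
  apply: ev_path_good => // c.
  by rewrite !inE => /or4P[] /eqP ->; apply: hQ; [left|left|right|right].
apply: ev_path_unlinked => // c; rewrite inE => /orP[/eqP ->|]; first by apply: hQ; left.
rewrite inE => /orP[/eqP ->|]; first by apply: hQ; right.
by rewrite !inE => /or4P[] /eqP ->; apply: hQ; [left|left|right|right].
Qed.

Lemma ev_fail_target Q a : (a < L)%N ->
  (forall c, c.1.1 = s \/ c.1.1 = step d s -> Q c) -> ev (zone Q) (fail_target s d a).
Proof.
move=> aL hQ; apply: ev_first_bad => b bL; last exact: ev_fail_path.
by apply: ev_hubs => //; apply: hQ; right.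
Qed.

Lemma ev_fail_edge Q : (forall c, c.1.1 = s \/ c.1.1 = step d s -> Q c) ->
  ev (zone Q) (fail_edge s d).
Proof.
move=> hQ; apply: ev_first_bad => a aL; last exact: ev_fail_target.
by apply: ev_hubs => //; apply: hQ; left.
Qed.

Lemma Pr_fail_target a : (a < L)%N ->
  Pr mu (first_at (hubs s) a `&` fail_target s d a) <=
  (5 * eta + (1 - P ^+ 4) ^+ m + (1 - P) ^+ L) * Pr mu (first_at (hubs s) a).
Proof.
move=> aL.
(* All of cell [s] and the earlier hubs of its neighbour, so that hub [b] of the neighbour is still
   unexplored. *)
pose Q (b : nat) : set code := [set c | c.1.1 = s \/
  (c.1.1 = step d s /\ exists2 b', (b' < b)%N & c.1.2 = Some b')].
have evA b : ev (zone (Q b)) (first_at (hubs s) a).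
  by apply: ev_first_at => i ia; apply: ev_hubs; [left|exact: leq_ltn_trans aL].
apply: Pr_first_bad.
- by rewrite addr_ge0 ?mulr_ge0 // exprn_ge0 // subr_ge0 exprn_ile1 // ?(ltW P_gt0) // P_le1.
- exact: P_le1.
- exact: ev_sub (evA 0%N).
- by move=> b bL; apply: (ev_sub (@subsetT _ _) (@ev_hubs setT _ b _ _)).
- by move=> b bL; apply: (ev_sub (@subsetT _ _) (@ev_fail_path setT a b _ _ _)).
- by move=> b bL; exact: Pr_fail_path.
- move=> b bL; apply: (@Pr_zone_not _ _ (Q b) [set hub_code (step d s) b]).
  + apply/seteqP; split=> // c [+ cE]; rewrite cE => -[/= E|[_ [b' b'b [bb']]]].
      by case: (step_neq E).
    by move: b'b; rewrite bb' ltnn.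
  + apply: evI => //; apply: ev_none_before => b' b'b; apply: ev_hubs; last exact: ltn_trans bL.
    by right; split=> //; exists b'.
  + exact: ev_hubs.
  + exact: Pr_g.
Qed.

(** The outermost search starts from the sure event; finding no hub in [s] accounts for the second
    [(1 - P) ^+ L]. *)
Lemma Pr_fail_edge :
  Pr mu (fail_edge s d) <= 5 * eta + (1 - P ^+ 4) ^+ m + (1 - P) ^+ L + (1 - P) ^+ L.
Proof.
have := @Pr_first_bad R Zn mu setT (hubs s) (fun a w => fail_target s d a w) L
  (5 * eta + (1 - P ^+ 4) ^+ m + (1 - P) ^+ L) P.
rewrite setTI PrT mulr1; apply.
- rewrite !addr_ge0 ?mulr_ge0 // exprn_ge0 // subr_ge0 ?P_le1 //.
  by rewrite exprn_ile1 // ?(ltW P_gt0) // P_le1.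
- exact: P_le1.
- exact: ev_cst setT True.
- by move=> a aL; apply: (ev_sub (@subsetT _ _) (@ev_hubs setT _ a _ _)).
- by move=> a aL; apply: (ev_sub (@subsetT _ _) (@ev_fail_target setT a _ _)).
- by move=> a aL; rewrite setTI; exact: Pr_fail_target.
- move=> a aL; rewrite setTI.
  apply: (@Pr_zone_not _ _ [set c | exists2 a', (a' < a)%N & c.1.2 = Some a'] [set hub_code s a]).
  + apply/seteqP; split=> // c [+ cE]; rewrite cE => -[a' a'a [aa']].
    by move: a'a; rewrite aa' ltnn.
  + apply: ev_none_before => a' a'a; apply: ev_hubs; last exact: ltn_trans aL.
    by exists a'.
  + exact: ev_hubs.
  + exact: Pr_g.
Qed.

End FailBounds.

(** * From linked cells to an infinite component *)

Definition joined (w : spanning Zn) (s s' : cell) : Prop := exists a b,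
  [/\ first_at (hubs s) a w, first_at (hubs s') b w &
      conn w (site (hub_code s a)) (site (hub_code s' b))].

Lemma first_at_unique (A : nat -> spanning Zn -> Prop) i i' w :
  first_at A i w -> first_at A i' w -> i = i'.
Proof.
move=> [ni Ai] [ni' Ai']; case: (ltngtP i i') => // ii'.
  by case: (ni' _ ii').
by case: (ni _ ii').
Qed.

Lemma joined_step s d w : ~ fail_edge s d w -> joined w s (step d s).
Proof.
move=> /existsNP[a /not_implyP[aL /not_implyP[fa]]].
move=> /existsNP[b /not_implyP[bL /not_implyP[fb]]].
move=> /existsNP[j /not_implyP[jm /not_implyP[[_ gj] lj]]].
exists a, b; split=> //.
have linkc l : l \in path_links s d a b j -> conn w (site l.1.1) (site l.1.2).
  move=> lp; have [h1 h2 _ lE _] := path_linksP aL bL jm lp.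
  have gsix c : c \in [:: hub_code s a, hub_code (step d s) b & path_codes s d a b j] -> gs c w.
    rewrite inE => /orP[/eqP ->|]; first exact: fa.2.
    rewrite inE => /orP[/eqP ->|]; first exact: fb.2.
    exact: gj.
  have lkl : lk (site l.1.1) l.2 w by apply: contrapT => nl; apply: lj; exists l.
  have g1 := gsix _ h1; have := gsix _ h2; rewrite /gs lE => g2.
  exact: g_lk_conn.
have l1 := linkc (hub_code s a, (s, Some a, Some j), connector j) ltac:(by rewrite !inE eqxx).
have l2 := linkc ((s, None, Some j), (s, Some a, Some j), hub a) ltac:(by rewrite !inE eqxx ?orbT).
have l3 := linkc ((s, None, Some j), (step d s, None, Some j), dir d)
  ltac:(by rewrite !inE eqxx ?orbT).
have l4 := linkc ((step d s, None, Some j), (step d s, Some b, Some j), hub b)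
  ltac:(by rewrite !inE eqxx ?orbT).
have l5 := linkc (hub_code (step d s) b, (step d s, Some b, Some j), connector j)
  ltac:(by rewrite !inE eqxx ?orbT).
have l13 := component_trans (component_trans l1 (component_sym l2)) l3.
exact: (component_trans (component_trans l13 l4) (component_sym l5)).
Qed.

(** Connections concatenate because the first good hub of a cell is unique. Equality is a separate
    case since a cell without good hub is not joined to itself. *)
Lemma linked_joined w s s' :
  linked (fun s d => ~ fail_edge s d w) s s' -> s = s' \/ joined w s s'.
Proof.
elim=> {s s'} [s s' [d nf ->]|s|s s' _ [->|h]|s s' s'' _ [->|h] _ [<-|h']].
- by right; exact: joined_step.
- by left.
- by left.
- right; have [a [b [fa fb ab]]] := h; exists b, a; split=> //.
  exact: component_sym.
- by left.
- by right.
- by right.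
- right; have [a [b [fa fb ab]]] := h; have [b' [c [fb' fc bc]]] := h'.
  move: bc; rewrite -(first_at_unique fb fb') => bc.
  by exists a, c; split=> //; exact: component_trans ab bc.
Qed.

Lemma all_open_infinite w : all_open (fun s d w => ~ fail_edge s d w) w ->
  exists x : subgraph w, infinite_set (component x).
Proof.
move=> aw; have far i : exists2 s : cell, (2 ^ i <= s.1)%N & joined w (0, 0)%N s.
  have [s si ls] := linked_unbounded aw i; exists s => //.
  by case: (linked_joined ls) => // s0; move: si; rewrite -s0 leqn0 expn_eq0.
have [_ _ [a0 [_ [fa0 _ _]]]] := far 0%N.
exists (site (hub_code (0, 0)%N a0) : Zn) => fin.
have Kn : (K < n)%N by lia.
(* Coordinate [K] of a hub is the abscissa of its cell, so a finite component would bound the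
   abscissas reached. *)
have /finite_seqP[l lE] : finite_set ((fun y : Zn => `|(y : 'rV[int]_n) ord0 (Ordinal Kn)|%N) @`
    component (G := subgraph w) (site (hub_code (0, 0)%N a0) : Zn)).
  exact: finite_image.
have [s si [a [b [fa fb ab]]]] := far (\max_(z <- l) z)%N.
have : [set` l] s.1.
  rewrite -lE; exists (site (hub_code s b)); first by rewrite -(first_at_unique fa fa0).
  by rewrite mxE /site_coord ltnn eqxx /= natz absz_nat.
move=> /= sl; have : (s.1 <= \max_(z <- l) z)%N by exact: (@leq_bigmax_seq _ l xpredT id).
by rewrite leqNgt (leq_trans _ si) // ltn_expl.
Qed.

Lemma percolates_of_blocks :
  2000 * (5 * eta + (1 - P ^+ 4) ^+ m + (1 - P) ^+ L + (1 - P) ^+ L) <= 1 ->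
  percolates mu.
Proof.
move=> small; pose E0 s d w := ~ fail_edge s d w.
pose reg0 (s : cell) : set Zn := zone [set c | c.1.1 = s].
have [||||||T1 h1] := @Pr_all_open R Zn mu reg0 E0 2000^-1.
- lra.
- lra.
- exact: mu_indep.
- by move=> s s' x [c [<- vc cx]] [c' [<- vc' cx']]; rewrite (site_inj vc vc' cx cx').
- move=> s d; apply: evC.
  apply: (@ev_sub _ _ (zone [set c | c.1.1 = s \/ c.1.1 = step d s])).
    by move=> y [c [[cs|cs] vc cy]]; [left|right]; exists c.
  exact: ev_fail_edge.
- move=> s d; have -> : [set w | ~ E0 s d w] = fail_edge s d.
    by apply/seteqP; split=> w; [exact: contrapT|move=> fw; apply].
  by apply: (le_trans (Pr_fail_edge s d)); lra.
have Tinf : ev setT [set w : spanning Zn | exists x : subgraph w, infinite_set (component x)].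
  exact: (@ev_infinite_component Zn 'rV[int]_n id id (fun=> erefl) (fun=> erefl)).
rewrite /percolates (PrE mu Tinf) lte_fin; apply: lt_le_trans h1 _.
by apply: (Pr_le mu T1 Tinf) => w; exact: all_open_infinite.
Qed.

End Cells.

(** * Golden ratio and conclusion *)

Lemma golden_ratio_sqr (R : realType) : golden_ratio R ^+ 2 = golden_ratio R + 1.
Proof.
have s5 : Num.sqrt 5 ^+ 2 = 5 :> R by rewrite sqr_sqrtr.
rewrite /golden_ratio; move: (Num.sqrt 5) s5 => s s5.
have -> : ((s + 1) / 2) ^+ 2 = (s ^+ 2 + 2 * s + 1) / 4 by field.
by rewrite s5; lra.
Qed.

Lemma golden_ratio_gt1 (R : realType) : 1 < golden_ratio R.
Proof.
have s5 : Num.sqrt 5 ^+ 2 = 5 :> R by rewrite sqr_sqrtr.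
have s0 : 0 <= Num.sqrt 5 :> R by exact: sqrtr_ge0.
by rewrite /golden_ratio; nra.
Qed.

Lemma good_bound_growth (R : realType) (p P : R) (k : nat) :
  0 <= 1 - p -> (0 < k)%N -> (1 - p) ^+ (2 ^ (k - 1)) * golden_ratio R < P ->
  forall eta : R, 0 < eta -> exists i, (forall j, (j <= i)%N -> 0 < good_bound p k P j) /\
    (1 - p) ^+ (2 ^ (k + i)) <= eta * good_bound p k P i ^+ 2.
Proof.
move=> p1 k0; set phi := golden_ratio R; set x := _ ^+ _ => xP eta eta0.
have phi1 : 1 < phi := golden_ratio_gt1 R.
have phi2 : phi ^+ 2 = phi + 1 := golden_ratio_sqr R.
have x0 : 0 <= x by exact: exprn_ge0.
have P0 : 0 < P by apply: le_lt_trans xP; rewrite mulr_ge0 // ltW // (lt_trans _ phi1).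
(* [d] is the margin above the golden ratio; when [x = 0], that is [p = 1], any positive value will
   do. *)
have [d d0 dP] : exists2 d, 0 < d & (phi + d) * x <= P.
  have [x00|x0'] := eqVneq x 0; first by exists 1; rewrite // x00 mulr0 ltW.
  have xp : 0 < x by rewrite lt_neqAle eq_sym x0' x0.
  exists (P / x - phi); first by rewrite subr_gt0 ltr_pdivlMr // mulrC.
  by rewrite addrC subrK divfK.
(* Thus [x ^+ (2 ^ i)] is the square root of [q_(k+i)], and [r] below is [r_(k+i)]. *)
have qE i : (1 - p) ^+ (2 ^ (k + i)) = (x ^+ (2 ^ i)) ^+ 2.
  have -> : (2 ^ (k + i) = 2 ^ (k - 1) * 2 ^ i * 2)%N.
    by rewrite -expnD -expnSr; congr (2 ^ _)%N; lia.
  by rewrite 2!exprM.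
(* The excess of the ratio over [phi] grows at least linearly; the product form of the bound also
   covers [x = 0]. *)
have inv i : 0 < good_bound p k P i /\ exists2 r, phi + d * i.+1%:R <= r &
    r * x ^+ (2 ^ i) <= good_bound p k P i.
  elim: i => [|i [B0 [r dr rB]]]; first by split=> //; exists (phi + d); rewrite ?mulr1 ?expr1.
  have X0 : 0 <= x ^+ (2 ^ i) by exact: exprn_ge0.
  have i1 : 1 <= i.+1%:R :> R by rewrite ler1n.
  have dn : 0 < d * i.+1%:R by rewrite mulr_gt0 // ltr0n.
  have E : good_bound p k P i.+1 = good_bound p k P i ^+ 2 - (x ^+ (2 ^ i)) ^+ 2.
    by rewrite -qE.
  have XE : x ^+ (2 ^ i.+1) = (x ^+ (2 ^ i)) ^+ 2 by rewrite -exprM expnSr.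
  rewrite E XE; move: (good_bound p k P i) (x ^+ (2 ^ i)) B0 X0 rB => B X B0 X0 rB.
  have r1 : 1 < r by lra.
  have XB : X < B.
    have [->//|X0'] := eqVneq X 0; have Xp : 0 < X by rewrite lt_neqAle eq_sym X0' X0.
    by apply: lt_le_trans rB; rewrite ltr_pMl.
  split; first by rewrite subr_sqr mulr_gt0 ?subr_gt0 // ltr_wpDr.
  exists (r ^+ 2 - 1).
    rewrite -natr1 mulrDr mulr1; set t := d * _ in dn dr *.
    have : d <= t by rewrite /t ler_peMr // ltW.
    (* Since [phi ^+ 2 - 1 = phi], [r >= phi + t] gives [r ^+ 2 - 1 >= phi + 2 * phi * t], and
       [2 * phi * t >= t + d]. *)
    move: phi2; rewrite !expr2; nra.
  rewrite mulrBl mul1r lerD2r -exprMn; rewrite ler_pXn2r // nnegrE.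
    by rewrite mulr_ge0 // ltW // (lt_trans _ r1).
  exact: ltW.
(* This makes [d * i] exceed [eta^-1], hence [eta * r >= 1] and [eta * r ^+ 2 >= 1]. *)
pose i := Num.bound (d^-1 * eta^-1).
have hi : d^-1 * eta^-1 < i%:R.
  by apply: archi_boundP; rewrite mulr_ge0 // invr_ge0 ltW.
exists i; split=> [j _|]; first exact: (inv j).1.
have [B0 [r dr rB]] := inv i.
have X0 : 0 <= x ^+ (2 ^ i) by exact: exprn_ge0.
have ri : eta^-1 <= r.
  have : eta^-1 <= d * i%:R by rewrite -ler_pdivrMl // ltW.
  by move: dr; rewrite -natr1 mulrDr mulr1; lra.
have r1 : 1 <= r.
  have : 0 <= d * i.+1%:R by rewrite mulr_ge0 // ltW.
  by lra.
rewrite qE; apply: (@le_trans _ _ (eta * (r * x ^+ (2 ^ i)) ^+ 2)).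
  rewrite exprMn mulrA ler_peMl ?exprn_ge0 //.
  have : 1 <= eta * r by rewrite -ler_pdivrMl // mulr1.
  by move=> er; rewrite expr2 mulrA (le_trans er) // ler_peMr // (le_trans _ er).
rewrite ler_wpM2l ?(ltW eta0) // ler_pXn2r // nnegrE; first by rewrite mulr_ge0 // (le_trans _ r1).
exact: ltW.
Qed.

(** [N] is produced before [a <= 1] is known: for the bound on good cubes, this inequality comes
    only from a given lattice model. *)
Lemma exists_expr_le (R : realType) (a t : R) : 0 < a -> 0 < t ->
  exists N, a <= 1 -> (1 - a) ^+ N <= t.
Proof.
move=> a0 t0; have [a1|a1] := leP a 1; last by exists 0%N.
have /cvgr0Pnorm_lt/(_ t t0) : (fun N => (1 - a) ^+ N) @ \oo --> (0 : R).
  by apply: cvg_expr; rewrite ger0_norm ?subr_ge0 //; lra.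
move=> [N _ /(_ N (leqnn N)) h]; exists N => _; apply: le_trans (ltW h).
exact: ler_norm.
Qed.

Lemma eventually_percolates (R : realType) (p : R) (k : nat) (P : R) :
  0 < p <= 1 -> (0 < k)%N -> (1 - p) ^+ (2 ^ (k - 1))%N * golden_ratio R < P ->
  (forall mu : model R (hypercube k), D_ge p mu ->
     (P%:E <= mu [set w | graph_connected (subgraph w)])%E) ->
  exists n0, forall n, (n0 <= n)%N -> forall mu : model R (lattice R n),
    D_ge p mu -> percolates mu.
Proof.
move=> p01 k0 hP hconn; have p1 : 0 <= 1 - p by rewrite subr_ge0; case/andP: p01.
(* The failure bound is [5 * eta] plus three powers of at most [eta] each, and
   [2000 * 8 = 16000]. *)
have [eta t0 etaS] : exists2 eta : R, 0 < eta & 16000 * eta <= 1 by exists 16000^-1; lra.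
have [i [Bpos Bq]] := good_bound_growth p1 k0 hP t0.
set B := good_bound p k P i in Bq; have B0 : 0 < B by exact: Bpos.
have [L hL] := exists_expr_le B0 t0.
have [m hm] := exists_expr_le (exprn_gt0 4 B0) t0.
exists ((k + i).+2 + L + m)%N => n hn mu muD.
have kn : (k <= n)%N by clear - hn; lia.
have Pg x : B <= Pr mu [set w | good kn i x w].
  by apply: (Pr_good muD hconn) => [|j /ltnW ji]; [clear - hn; lia|exact/ltW/Bpos].
have B1 : B <= 1.
  exact: (le_trans (Pg 0) (Pr_le1 mu (@ev_good _ _ _ kn i 0))).
apply: (@percolates_of_blocks R n (k + i) L m hn mu (good kn i) (@link R n (k + i)) B eta).
- exact: muD.1.
- by move=> x; exact: ev_good.
- by move=> x d Kd; exact: ev_link.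
- by [].
- exact: ltW.
- exact: Pg.
- by move=> x d Kd dn; apply: le_trans Bq; exact: Pr_link.
- by move=> x d w; exact: good_link_conn.
- have := hm (exprn_ile1 _ (ltW B0) B1); have := hL B1.
  by move: (_ ^+ L) (_ ^+ m) => u v; clear - etaS; lra.
Qed.

(** * Monotonicity of [p_max] in the dimension and the limit *)

Section LatticeRestriction.
Variables (R : realType) (n : nat).

Definition pad (x : lattice R n) : lattice R (n + 1) := row_mx (x : 'rV[int]_n) (0 : 'rV[int]_1).

Lemma pad_inj : injective pad.
Proof. by move=> x y /(congr1 lsubmx); rewrite !row_mxKl. Qed.

Lemma pad_adj x y : adj (lattice R n) x y -> adj (lattice R (n + 1)) (pad x) (pad y).
Proof.
rewrite /= /lattice_adj /euclidean_dist /pad big_split_ord /= big_ord1 !row_mxEr !mxE.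
rewrite subrr expr0n addr0 => xy; rewrite -[RHS]xy; congr Num.sqrt; apply: eq_bigr => i _.
by rewrite !row_mxEl.
Qed.

Lemma ev_infinite_lattice n' : ev setT
  [set w : spanning (lattice R n') | exists x : subgraph w, infinite_set (component x)].
Proof.
exact: (@ev_infinite_component (lattice R n') 'rV[int]_n' id id (fun=> erefl) (fun=> erefl)).
Qed.

Lemma pull_percolates (mu : model R (lattice R (n + 1))) :
  percolates (pull_model pad_adj mu) -> percolates mu.
Proof.
have T := @ev_infinite_lattice n; have T1 := @ev_infinite_lattice (n + 1).
have T' := ev_pull pad_adj T.
move=> perc; apply: (lt_le_trans perc); rewrite (PrE mu T1).
apply: (@le_trans _ _ (Pr mu (pull pad_adj @^-1`
  [set w : spanning (lattice R n) | exists x : subgraph w, infinite_set (component x)]))%:E).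
  by have /eqP := PrE mu T'; rewrite eq_le => /andP[].
rewrite lee_fin; apply: (Pr_le mu T' T1) => w.
exact: (@pull_infinite _ _ pad pad_inj pad_adj w).
Qed.

End LatticeRestriction.

(** The supremum of the empty set is 0 by convention, whence [0 <= x]. *)
Lemma sup_le_ge0 (R : realType) (A : set R) (x : R) :
  0 <= x -> (forall a, A a -> a <= x) -> sup A <= x.
Proof.
move=> x0 Ax; have [->|A0] := eqVneq A set0; first by rewrite sup0.
by apply: ge_sup => //; exact/set0P.
Qed.

Lemma p_max_ge0 (R : realType) (G : graph) : 0 <= p_max R G.
Proof.
rewrite /p_max; set A := [set p | _].
have [->|/set0P[a Aa]] := eqVneq A set0; first by rewrite sup0.
have [/andP[a0 _] _] := Aa; apply: (le_trans a0); apply: ub_le_sup => //.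
by exists 1 => b [/andP[]].
Qed.

(** A model that does not percolate restricts to one on a hyperplane that does not percolate
    either. *)
Lemma p_max_nonincreasing (R : realType) (n : nat) :
  p_max R (lattice R n.+1) <= p_max R (lattice R n).
Proof.
rewrite -addn1; apply: sup_le_ge0; first exact: p_max_ge0.
move=> q [q01 [mu muD nperc]]; apply: ub_le_sup.
  by exists 1 => b [/andP[]].
split=> //; exists (pull_model (@pad_adj R n) mu).
  by apply: pull_D_ge => //; exact: pad_inj.
by move=> /pull_percolates.
Qed.

Theorem theorem1p7 (R : realType) (p : R) (k : nat) (P : R)
  (hp : 0 < p <= 1) (hk : (0 < k)%N)
  (hP : (1 - p) ^+ (2 ^ (k - 1))%N * golden_ratio R < P)
  (hconn : forall mu : model R (hypercube k), D_ge p mu ->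
     (P%:E <= mu [set w | graph_connected (subgraph w)])%E) :
  (\forall n \near \oo,
     forall mu : model R (lattice R n), D_ge p mu -> percolates mu) /\
  (cvgn (fun n => p_max R (lattice R n)) /\
   limn (fun n => p_max R (lattice R n)) <= p).
Proof.
have [n0 perc] := eventually_percolates hp hk hP hconn.
have cvg_pmax : cvgn (fun n => p_max R (lattice R n)).
  apply: nonincreasing_is_cvgn.
    by apply/nonincreasing_seqP => n; exact: p_max_nonincreasing.
  by exists 0 => _ [n _ <-]; exact: p_max_ge0.
split; first by exists n0 => // n /= n0n; exact: perc.
split=> //; apply: limr_le => //; exists n0 => // n /= n0n.
apply: sup_le_ge0; first by case/andP: hp => /ltW.
(* If [q > p], the model also lies in [D_ge p], so it percolates. *)
move=> q [_ [mu [ind muq] nperc]]; rewrite leNgt; apply/negP => pq; apply: nperc.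
apply: (perc n n0n); split=> // f; apply: le_trans (muq f).
by rewrite lee_fin ltW.
Qed.
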